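(* Let $a,m>0$. The problem $$\left\{\begin{array}{l}-\Delta u=(1-u^2)u\quad\text{in }\mathbb R\times\mathbb R_+,\\[2pt] -\frac1m\Delta u=-a\,u\quad\text{in }\mathbb R\times\mathbb R_-,\\[2pt] \frac{\partial u}{\partial x_2}(x_1,0_+)=\frac1m\frac{\partial u}{\partial x_2}(x_1,0_-),\quad u(x_1,0_+)=u(x_1,0_-)\quad\text{for all }x_1\in\mathbb R,\end{array}\right.$$ admits a unique solution in the class $$\mathcal C=\{u\in L^\infty(\mathbb R^2):\ u|_{\mathbb R\times\mathbb R_\pm}\in C^2(\overline{\mathbb R\times\mathbb R_\pm}),\ u\ge0\text{ in }\mathbb R^2\},$$ which is given by $\mathbb R^2\ni(x_1,x_2)\mapsto U(x_2)$, where $U$ is the function defined in the context.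
   Context: $\mathbb R_+$ and $\mathbb R_-$ are the positive and negative half-lines; $0_\pm$ denote one-sided limits; $u|_{\mathbb R\times\mathbb R_\pm}\in C^2(\overline{\mathbb R\times\mathbb R_\pm})$ means that the restriction of $u$ to each open half-plane is $C^2$ up to the boundary. The function $U:\mathbb R\to\mathbb R$ is $$U(t)=\frac{\beta e^{\sqrt2\,t}-1}{\beta e^{\sqrt2\,t}+1}\ (t\ge0),\qquad U(t)=A\,e^{\sqrt{am}\,t}\ (t<0),$$ $$\beta=\frac{\sqrt{2m}+\sqrt{a+2m}}{\sqrt a},\qquad A=\frac{\sqrt{2m}+\sqrt{a+2m}-\sqrt a}{\sqrt{2m}+\sqrt{a+2m}+\sqrt a}.$$
   Formalization: Uniqueness is stated among solutions in the class that are not zero almost everywhere, because u = 0 also lies in the class and solves the problem, so the claim as written fails. *)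

(* Defs.v *)
From HB Require Import structures.
From mathcomp Require Export all_boot all_order all_algebra.
From mathcomp Require Export all_classical all_reals all_analysis.

Set Implicit Arguments.
Unset Strict Implicit.
Unset Printing Implicit Defensive.

Import Order.TTheory GRing.Theory Num.Theory.
Import numFieldNormedType.Exports.

Local Open Scope classical_set_scope.
Local Open Scope ring_scope.

Section Plane.
Context {R : realType}.
Implicit Types (u : R * R -> R) (V : set (R * R)).

Definition lebesgue2 := (@lebesgue_measure R \x @lebesgue_measure R)%E.

Definition upper_half : set (R * R) := [set x | 0 < x.2].
Definition lower_half : set (R * R) := [set x | x.2 < 0].

Definition e1 : R * R := (1, 0).
Definition e2 : R * R := (0, 1).

Definition laplacian u (x : R * R) : R :=
  'D_e1 ('D_e1 u) x + 'D_e2 ('D_e2 u) x.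

Definition extends_to_closure V u : Prop :=
  exists g : R * R -> R,
    {within closure V, continuous g} /\ forall x, V x -> g x = u x.

(* Meant for V open: the derivatives at points of V then depend only on the
   restriction of u to V. *)
Definition C2_closure V u : Prop :=
  [/\ extends_to_closure V u,
      forall i, i \in [:: e1; e2] ->
        (forall x, V x -> derivable u x i) /\
        extends_to_closure V ('D_i u)
    & forall i j, i \in [:: e1; e2] -> j \in [:: e1; e2] ->
        (forall x, V x -> derivable ('D_i u) x j) /\
        extends_to_closure V ('D_j ('D_i u))].

(* The elements of L^oo are represented by functions, so that members of this
   class are to be compared up to equality lebesgue2-almost everywhere; the
   values on the line x_2 = 0 are immaterial. *)
Definition classC u : Prop :=
  [/\ u \in Lfun lebesgue2 +oo%E,
      C2_closure upper_half u,
      C2_closure lower_half u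
    & forall x, 0 <= u x].

Definition transmission_solution (a m : R) u : Prop :=
  [/\ forall x, upper_half x -> - laplacian u x = (1 - u x ^+ 2) * u x,
      forall x, lower_half x -> - (m^-1 * laplacian u x) = - (a * u x),
      forall x1 : R, exists2 l : R,
        'D_e2 u (x1, t) @[t --> 0^'+] --> m^-1 * l &
        'D_e2 u (x1, t) @[t --> 0^'-] --> l
    & forall x1 : R, exists2 l : R,
        u (x1, t) @[t --> 0^'+] --> l &
        u (x1, t) @[t --> 0^'-] --> l].

(* The zero function belongs to classC and solves the problem for all a and m,
   so uniqueness can only be meant among the solutions that are not zero in
   L^oo. *)
Definition nontrivial u : Prop := ~ {ae lebesgue2, forall x, u x = 0}.

End Plane.

Section Profile.
Context {R : realType}.
Implicit Types a m t : R.

Definition beta a m : R :=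
  (Num.sqrt (2 * m) + Num.sqrt (a + 2 * m)) / Num.sqrt a.

Definition amplitude a m : R :=
  (Num.sqrt (2 * m) + Num.sqrt (a + 2 * m) - Num.sqrt a) /
  (Num.sqrt (2 * m) + Num.sqrt (a + 2 * m) + Num.sqrt a).

Definition U a m t : R :=
  if 0 <= t then
    (beta a m * expR (Num.sqrt 2 * t) - 1) /
    (beta a m * expR (Num.sqrt 2 * t) + 1)
  else amplitude a m * expR (Num.sqrt (a * m) * t).

End Profile.

(* Main.v *)
Require Import Defs.
From mathcomp Require Import ring lra measurable_realfun ess_sup_inf.
Import Order.TTheory GRing.Theory Num.Theory.
Import numFieldNormedType.Exports.
Local Open Scope classical_set_scope.
Local Open Scope ring_scope.

Set Implicit Arguments.
Unset Strict Implicit.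
Unset Printing Implicit Defensive.

(* The quotient q = w / U of a solution by the profile satisfies
     Lap q + 2 (U' / U) q_y = U^2 q (q^2 - 1)  for y > 0,
     Lap q + 2 sqrt (a m) q_y = 0              for y < 0,
     q_y(0+) = q_y(0-) / m,
   so the nonlinearity acts on q as a monotone zero-order term wherever q >= 1,
   and with the favourable sign wherever 0 <= q <= 1.  Penalizing by a small
   multiple of a coercive function with a strict kink at y = 0 produces maxima and
   minima, which cannot lie on the interface or below it.  At a maximum with q > 1
   above the interface the equation is violated, whence q <= 1.  Then w is
   superharmonic above the interface, hence positive there or zero; comparing with
   (r^2 - |x|^2)^2 on large discs gives w^2 >= 1 - 8 / r^2 at height > r, and the
   minimum principle carries this bound down to every point below. Letting r tend
   to infinity yields q >= 1. *)

(** * Calculus of one variable *)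

(** For the difference of two solutions the zero-order coefficient above the interface has no sign;
    dividing by the positive solution [U] is what produces a maximum principle. The price is that
    [q] may be unbounded: below the interface [U] decays like [exp (kappa y)], with
    [kappa = sqrt (a m)], so boundedness of [w] only gives [q = O(exp (- kappa y))]. An exponential
    penalty [exp (- lam y)] thus needs [lam > kappa] to win at infinity, and [lam < 2 kappa] to be a
    strict supersolution of [Lap + 2 kappa d/dy]. At the interface only one-sided limits of normal
    derivatives are available, so contact there is tested from each side separately. The cubic term
    is odd, so a sign [s] with [s ^+ 2 = 1] treats maxima of [q] and of [- q] at once. Since 0 is
    also a solution, comparison alone cannot give the lower bound: positivity at one point has to be
    spread over the upper half-plane, and an explicit subsolution with a pole does this in a single
    step, without a chain of discs. *)

Section OneVariable.
Context {R : realType}.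
Implicit Types (g : R -> R) (r t : R).

Lemma near_rightP (P : R -> Prop) :
  (\forall t \near 0^'+, P t) <->
  exists2 e, 0 < e & forall t, 0 < t < e -> P t.
Proof.
split=> [|[e e0 eP]].
  rewrite /at_right !near_withinE => /nbhs_ballP[e /= e0 eP]; exists e => // t /andP[t0 te].
  by apply: eP => //; rewrite /ball /= sub0r normrN gtr0_norm.
near=> t; apply: eP; apply/andP; split; first by near: t; exact: nbhs_right_gt.
by near: t; exact: nbhs_right_lt.
Unshelve. all: by end_near. Qed.

Lemma is_derive_cvg g t (dg : R) :
  is_derive t 1 g dg -> h^-1 * (g (h + t) - g t) @[h --> 0^'] --> dg.
Proof.
move=> [df <-]; move: df; rewrite /derive => /cvg_ex[l gl].
have E : (fun h => h^-1 *: ((g \o shift t) (h *: (1 : R)) - g t)) =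
         (fun h => h^-1 * (g (h + t) - g t)).
  by apply/funext => h /=; rewrite /GRing.scale /= mulr1.
by rewrite -E (cvg_lim _ gl).
Qed.

Lemma is_derive_add g (h : R -> R) (t dg dh : R) :
  is_derive t 1 g dg -> is_derive t 1 h dh -> is_derive t 1 (fun x => g x + h x) (dg + dh).
Proof. exact: is_deriveD. Qed.

Lemma is_derive_sub g (h : R -> R) (t dg dh : R) :
  is_derive t 1 g dg -> is_derive t 1 h dh -> is_derive t 1 (fun x => g x - h x) (dg - dh).
Proof. exact: is_deriveB. Qed.

Lemma is_derive_scale (c : R) g (t dg : R) :
  is_derive t 1 g dg -> is_derive t 1 (fun x => c * g x) (c * dg).
Proof. exact: is_deriveZ. Qed.

Lemma is_derive_mul g (h : R -> R) (t dg dh : R) :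
  is_derive t 1 g dg -> is_derive t 1 h dh ->
  is_derive t 1 (fun x => g x * h x) (g t * dh + h t * dg).
Proof. exact: is_deriveM. Qed.

Lemma is_derive_inv (g : R -> R) (t dg : R) : is_derive t 1 g dg -> g t != 0 ->
  is_derive t 1 (fun x => (g x)^-1) (- (dg * (g t)^-1 ^+ 2)).
Proof.
move=> h g0; have h' := is_deriveV g0 h; apply: is_derive_eq h' _.
by rewrite /GRing.scale /= exprVn mulNr mulrC.
Qed.

Lemma is_derive_const (c t : R) : is_derive t 1 (fun=> c) (0 : R).
Proof. exact: is_derive_cst. Qed.

Lemma is_derive_var (t : R) : is_derive t 1 (fun x : R => x) (1 : R).
Proof. exact: is_derive_id. Qed.

Lemma is_derive_sqr (t : R) : is_derive t 1 (fun x : R => x ^+ 2) (2 * t).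
Proof.
have E : t * 1 + t * 1 = 2 * t by ring.
exact: is_derive_eq (is_derive_mul (is_derive_var t) (is_derive_var t)) E.
Qed.

Lemma is_derive_continuous g (g1 : R -> R) :
  (forall t : R, is_derive t 1 g (g1 t)) -> continuous g.
Proof.
move=> dg t; apply/differentiable_continuous/derivable1_diffP.
by case: (dg t).
Qed.

(** A positive [g2] makes [g1], which vanishes at [t0] by Fermat's rule, positive just to the right
    of [t0]; the mean value theorem then produces a value of [g] above the maximum. *)
Lemma second_derivative_at_max g (g1 : R -> R) (g2 t0 r : R) : 0 < r ->
  (forall t, `|t - t0| < r -> is_derive t 1 g (g1 t)) -> is_derive t0 1 g1 g2 ->
  (forall t, `|t - t0| < r -> g t <= g t0) -> g2 <= 0.
Proof.
move=> r0 dg dg1 gmax; rewrite leNgt; apply/negP => g2_gt0.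
have near_t0 t : t \in `]t0 - r, t0 + r[ -> `|t - t0| < r.
  by rewrite in_itv/= ltr_norml; lra.
have g10 : g1 t0 = 0.
  have : is_derive t0 1 g 0.
    apply: (@derive1_at_max _ g (t0 - r) (t0 + r) t0).
    - lra.
    - by move=> t /near_t0 /dg[].
    - by rewrite in_itv/=; lra.
    - by move=> t /near_t0 /gmax.
  move=> [_ E]; have n0 : `|t0 - t0| < r by rewrite subrr normr0.
  by have [_ <-] := dg _ n0.
have := is_derive_cvg dg1; move=> /cvgr_gt/(_ _ g2_gt0).
move=> /nbhs_ballP[e /= e0 eP].
have m0 : 0 < Num.min e r by rewrite lt_min e0.
pose h := Num.min e r / 2.
have h0 : 0 < h by rewrite divr_gt0.
have he : h < e.
  by have := ge_min e e r; rewrite lexx /= /h => ?; lra.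
have hr : h < r.
  by have := ge_min r e r; rewrite lexx orbT /h => ?; lra.
have [c] : exists2 c, c \in `]t0, t0 + h[%R & g (t0 + h) - g t0 = g1 c * (t0 + h - t0).
  apply: MVT => //; first lra.
    by move=> t; rewrite in_itv/= => th; apply/dg/near_t0; rewrite in_itv/=; lra.
  apply: derivable_within_continuous => t; rewrite in_itv/= => th.
  have n0 : `|t - t0| < r by apply: near_t0; rewrite in_itv/=; lra.
  by case: (dg _ n0).
rewrite in_itv/= addrAC subrr add0r => /andP[c0 ch] E.
have ct0 : 0 < c - t0 by lra.
have : 0 < g1 c.
  have := eP (c - t0); rewrite /ball /= sub0r normrN gtr0_norm// subrK g10 subr0.
  rewrite pmulr_rgt0 ?invr_gt0//; apply; first lra.
  by rewrite gt_eqF.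
have : g (t0 + h) <= g t0 by apply/gmax/near_t0; rewrite in_itv/=; lra.
move=> A B; have := mulr_gt0 B h0; lra.
Qed.

(** At the interface a solution comes with a limit of derivatives rather than a derivative, so the
    sign is read off from the mean value theorem on [[0, h]]. *)
Lemma right_derivative_at_max g (g1 : R -> R) (l r : R) : 0 < r ->
  g t @[t --> 0^'+] --> g 0 ->
  (forall t, 0 < t < r -> is_derive t 1 g (g1 t)) ->
  g1 t @[t --> 0^'+] --> l ->
  (forall t, 0 < t < r -> g t <= g 0) -> l <= 0.
Proof.
move=> r0 cg dg g1l gmax; rewrite leNgt; apply/negP => l0.
have /near_rightP[e e0 eP] : \forall t \near 0^'+, 0 < g1 t.
  by move/cvgr_gt : g1l => /(_ _ l0).
have m0 : 0 < Num.min e r by rewrite lt_min e0.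
pose h := Num.min e r / 2.
have h0 : 0 < h by rewrite divr_gt0.
have he : h < e.
  by have := ge_min e e r; rewrite lexx /= /h => ?; lra.
have hr : h < r.
  by have := ge_min r e r; rewrite lexx orbT /h => ?; lra.
have dh t : 0 < t <= h -> is_derive t 1 g (g1 t) by move=> th; apply: dg; lra.
have [c] : exists2 c, c \in `]0, h[%R & g h - g 0 = g1 c * (h - 0).
  apply: MVT => //.
    by move=> t; rewrite in_itv/= => th; apply: dh; lra.
  apply/continuous_within_itvP => //; split => //.
    move=> t; rewrite in_itv/= => /andP[t0 th].
    apply/differentiable_continuous/derivable1_diffP.
    have ht : 0 < t <= h by lra.
    by case: (dh _ ht).
  apply: cvg_at_left_filter.
  apply/differentiable_continuous/derivable1_diffP.
  have hh : 0 < h <= h by lra.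
  by case: (dh _ hh).
rewrite in_itv/= subr0 => /andP[c0 ch] E.
have A : 0 < g1 c by apply: eP; lra.
have := gmax h; have := mulr_gt0 A h0; lra.
Qed.

Lemma left_derivative_at_max g (g1 : R -> R) (l r : R) : 0 < r ->
  g t @[t --> 0^'-] --> g 0 ->
  (forall t, - r < t < 0 -> is_derive t 1 g (g1 t)) ->
  g1 t @[t --> 0^'-] --> l ->
  (forall t, - r < t < 0 -> g t <= g 0) -> 0 <= l.
Proof.
move=> r0 cg dg g1l gmax; rewrite -oppr_le0.
apply: (@right_derivative_at_max (g \o -%R) (fun t => - g1 (- t)) (- l) r) => //=.
- by rewrite oppr0 -[X in X^'+]oppr0; apply/cvg_at_leftNP.
- move=> t tr; rewrite -mulrN1.
  have H : is_derive (- t) 1 g (g1 (- t)) by apply: dg; lra.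
  exact: (is_derive1_comp H).
- apply: cvgN; rewrite -[X in X^'+]oppr0.
  by move/cvg_at_leftNP : g1l.
- by move=> t tr; rewrite oppr0; apply: gmax; lra.
Qed.

Lemma glue_continuous (f g : R -> R) : continuous f -> continuous g -> f 0 = g 0 ->
  continuous (fun t => if 0 <= t then f t else g t).
Proof.
move=> cf cg fg0.
(* For either sign of [t] one of the two clamped terms equals [f 0 = g 0] and cancels. *)
have -> : (fun t => if 0 <= t then f t else g t) =
    (fun t => f (Num.max t 0) + g (Num.min t 0) - f 0).
  apply/funext => t; case: leP => t0; first by rewrite fg0 addrK.
  by rewrite addrAC subrr add0r.
have cmx : continuous (f \o (fun x : R^o => Num.max x 0)).
  move=> x; apply: continuous_comp; last exact: cf.
  by apply: (@continuous_max R R^o id (cst 0)); [exact: cvg_id|exact: cvg_cst].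
have cmn : continuous (g \o (fun x : R^o => Num.min x 0)).
  move=> x; apply: continuous_comp; last exact: cg.
  by apply: (@continuous_min R R^o id (cst 0)); [exact: cvg_id|exact: cvg_cst].
by move=> t; apply: (cvgB (cvgD (cmx t) (cmn t))); exact: cvg_cst.
Qed.

End OneVariable.

(** * The profile *)

Section ProfileFacts.
Context {R : realType}.
Variables (a m : R).
Hypotheses (ha : 0 < a) (hm : 0 < m).

Definition decay_rate := Num.sqrt (a * m).

Definition upper_profile (t : R) :=
  (beta a m * expR (Num.sqrt 2 * t) - 1) / (beta a m * expR (Num.sqrt 2 * t) + 1).

Definition lower_profile (t : R) := amplitude a m * expR (decay_rate * t).

Local Notation kappa := decay_rate.
Local Notation V := upper_profile.
Local Notation E := lower_profile.
Local Notation A := (amplitude a m).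

Lemma UE t : U a m t = if 0 <= t then V t else E t.
Proof. by []. Qed.

Lemma decay_rate_gt0 : 0 < kappa.
Proof. by rewrite sqrtr_gt0 mulr_gt0. Qed.

Lemma sqr_decay_rate : kappa ^+ 2 = a * m.
Proof. by rewrite sqr_sqrtr// ltW// mulr_gt0. Qed.

Lemma sqrt2_gt0 : 0 < Num.sqrt 2 :> R.
Proof. by rewrite sqrtr_gt0. Qed.

Lemma sqr_sqrt2 : Num.sqrt 2 ^+ 2 = 2 :> R.
Proof. by rewrite sqr_sqrtr. Qed.

Lemma beta_gt1 : 1 < beta a m.
Proof.
rewrite /beta ltr_pdivlMr ?sqrtr_gt0// mul1r.
have : Num.sqrt a < Num.sqrt (a + 2 * m) by rewrite ltr_sqrt; move: ha hm; lra.
have : 0 < Num.sqrt (2 * m) by rewrite sqrtr_gt0; move: ha hm; lra.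
lra.
Qed.

Lemma amplitudeE : A = (beta a m - 1) / (beta a m + 1).
Proof.
rewrite /amplitude /beta.
have := beta_gt1; rewrite /beta ltr_pdivlMr ?sqrtr_gt0// mul1r.
have : 0 < Num.sqrt a by rewrite sqrtr_gt0.
move: (Num.sqrt a) (Num.sqrt (2 * m)) (Num.sqrt (a + 2 * m)) => x y z x0 xyz.
by field; rewrite !gt_eqF //=; lra.
Qed.

Lemma upper_profile0 : V 0 = A.
Proof. by rewrite amplitudeE /V mulr0 expR0 mulr1. Qed.

Lemma lower_profile0 : E 0 = A.
Proof. by rewrite /E mulr0 expR0 mulr1. Qed.

Lemma amplitude_gt0 : 0 < A.
Proof. by rewrite amplitudeE divr_gt0//; have := beta_gt1; lra. Qed.

Lemma upper_profile_lt1 t : V t < 1.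
Proof.
rewrite /V; have := mulr_gt0 (lt_trans ltr01 beta_gt1) (expR_gt0 (Num.sqrt 2 * t)).
by move: (_ * expR _) => z z0; rewrite ltr_pdivrMr; lra.
Qed.

Lemma upper_profile_ge t : 0 <= t -> A <= V t.
Proof.
move=> t0; rewrite amplitudeE /V.
have b1 := beta_gt1.
have e1 : 1 <= expR (Num.sqrt 2 * t).
  by rewrite -expR0 ler_expR mulr_ge0// ltW// sqrt2_gt0.
have : beta a m <= beta a m * expR (Num.sqrt 2 * t) by rewrite ler_peMr//; lra.
move: (_ * expR _) => z z0.
rewrite ler_pdivrMr; last lra.
rewrite mulrAC ler_pdivlMr; last lra.
nra.
Qed.

Lemma amplitude_lt1 : A < 1.
Proof. by rewrite -upper_profile0 upper_profile_lt1. Qed.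

Lemma upper_profile_gt0 t : 0 <= t -> 0 < V t.
Proof. by move=> /upper_profile_ge; exact/lt_le_trans/amplitude_gt0. Qed.

Lemma lower_profile_gt0 t : 0 < E t.
Proof. by rewrite mulr_gt0 ?amplitude_gt0 ?expR_gt0. Qed.

Lemma U_gt0 t : 0 < U a m t.
Proof.
by rewrite UE; case: ifP => [/upper_profile_gt0//|_]; exact: lower_profile_gt0.
Qed.

Lemma U_lt1 t : U a m t < 1.
Proof.
rewrite UE; case: ifPn => [_|]; first exact: upper_profile_lt1.
rewrite -ltNge => t0; rewrite (le_lt_trans _ amplitude_lt1)//.
rewrite /E ler_piMr ?(ltW amplitude_gt0)// expR_le1 pmulr_rle0 ?decay_rate_gt0//.
exact: ltW.
Qed.

(** [V] is a translate of [tanh (t / sqrt 2)], whose derivative is this polynomial in [V];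
    differentiating it again gives [V'' = - (1 - V^2) V]. *)
Definition upper_profile' (t : R) := (1 - V t ^+ 2) / Num.sqrt 2.

Local Notation V' := upper_profile'.

Lemma is_derive_upper_profile (t : R) : is_derive t 1 V (V' t).
Proof.
have D0 : beta a m * expR (Num.sqrt 2 * t) + 1 != 0.
  by rewrite gt_eqF// ltr_pwDl// mulr_gt0 ?expR_gt0// (lt_trans _ beta_gt1).
have de : is_derive t 1 (fun t => beta a m * expR (Num.sqrt 2 * t))
   (Num.sqrt 2 * (beta a m * expR (Num.sqrt 2 * t))).
  have h : is_derive t 1 (fun t : R => Num.sqrt 2 * t) (Num.sqrt 2).
    by apply: is_derive_eq; rewrite /GRing.scale /= mulr1.
  have h' := is_derive1_comp (is_derive_expR _) h.
  by apply: is_derive_eq; rewrite /GRing.scale /=; ring.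
have [de1 de2] := de.
set b := (fun t => _ : R) in de de1 de2.
have dn : is_derive t 1 (fun t => b t - 1) (Num.sqrt 2 * b t).
  by apply: is_derive_eq; rewrite subr0.
have dd : is_derive t 1 (fun t => b t + 1) (Num.sqrt 2 * b t).
  by apply: is_derive_eq; rewrite addr0.
have dv : is_derive t 1 (fun t => (b t + 1)^-1) (- (b t + 1) ^- 2 *: (Num.sqrt 2 * b t)).
  exact: is_deriveV.
have -> : V = (fun t => b t - 1) * (fun t => (b t + 1)^-1) by [].
apply: is_derive_eq; rewrite /V' /V -/(b t) /GRing.scale /=.
have s0 := sqrt2_gt0; have s2 := sqr_sqrt2.
have s20 : Num.sqrt 2 != 0 :> R by rewrite gt_eqF.
apply: (mulfI s20).
rewrite [RHS]mulrC divfK//.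
transitivity (Num.sqrt 2 ^+ 2 * (b t * (- (b t - 1) / (b t + 1) ^+ 2 + (b t + 1)^-1))).
  by ring.
by rewrite s2; field.
Qed.

Lemma is_derive_upper_profile' (t : R) : is_derive t 1 V' (- ((1 - V t ^+ 2) * V t)).
Proof.
have d := is_derive_upper_profile t.
have -> : V' = (Num.sqrt 2)^-1 *: (fun t => 1 - V t * V t).
  by apply/funext => x; rewrite /V' mulrC expr2.
have d2 : is_derive t 1 (V * V) (2 * V t * V' t).
  by apply: is_derive_eq; rewrite /GRing.scale /=; ring.
have d3 : is_derive t 1 (fun x => 1 - V x * V x) (- (2 * V t * V' t)).
  by apply: is_derive_eq; rewrite add0r mul1r.
apply: is_derive_eq; rewrite /GRing.scale /= /V'.
have s20 : Num.sqrt 2 != 0 :> R by rewrite gt_eqF ?sqrt2_gt0.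
transitivity (- (2 / Num.sqrt 2 ^+ 2 * V t * (1 - V t ^+ 2))).
  by field.
by rewrite sqr_sqrt2; field.
Qed.

Lemma is_derive_lower_profile (t : R) : is_derive t 1 E (kappa * E t).
Proof.
have h : is_derive t 1 (fun t : R => kappa * t) kappa.
  by apply: is_derive_eq; rewrite /GRing.scale /= mulr1.
have h' := is_derive1_comp (is_derive_expR _) h.
suff : is_derive t 1 (A *: (expR \o (fun t => kappa * t))) (kappa * E t) by [].
by apply: is_derive_eq; rewrite /E /GRing.scale /=; ring.
Qed.

(** Balance of fluxes at the interface. It amounts to the quadratic equation
    [1 - A^2 = sqrt 2 * (kappa / m) * A], whose positive root is the given amplitude. *)
Lemma upper_profile'0 : V' 0 = m^-1 * (kappa * A).
Proof.
rewrite /V' upper_profile0 /kappa.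
have s0 := sqrt2_gt0; have s2 := sqr_sqrt2.
rewrite sqrtrM ?(ltW ha)// /amplitude sqrtrM//.
have q2 : Num.sqrt (a + 2 * m) ^+ 2 = a + 2 * m by rewrite sqr_sqrtr; move: ha hm; lra.
have q0 : 0 < Num.sqrt (a + 2 * m) by rewrite sqrtr_gt0; move: ha hm; lra.
have r2 : Num.sqrt a ^+ 2 = a by rewrite sqr_sqrtr; move: ha hm; lra.
have r0 : 0 < Num.sqrt a by rewrite sqrtr_gt0; move: ha hm; lra.
have w2 : Num.sqrt m ^+ 2 = m by rewrite sqr_sqrtr; move: ha hm; lra.
have w0 : 0 < Num.sqrt m by rewrite sqrtr_gt0; move: ha hm; lra.
have qr : Num.sqrt (a + 2 * m) ^+ 2 = Num.sqrt a ^+ 2 + Num.sqrt 2 ^+ 2 * Num.sqrt m ^+ 2.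
  by rewrite q2 r2 w2 s2.
have -> : m^-1 = (Num.sqrt m ^+ 2)^-1 by rewrite w2.
move: s0 s2 q0 r0 w0 qr.
move: (Num.sqrt (a + _)) (Num.sqrt (2 : R)) (Num.sqrt m) (Num.sqrt a) => q s w r.
move=> s0 s2 q0 r0 w0 qr.
have s00 : s != 0 by rewrite gt_eqF.
have w00 : w != 0 by rewrite gt_eqF.
have d00 : s * w + q + r != 0 by rewrite gt_eqF// !addr_gt0// mulr_gt0.
apply/eqP; rewrite -subr_eq0; apply/eqP.
transitivity ((4 * (s * w + q) * r * w - s * r * ((s * w + q) ^+ 2 - r ^+ 2))
   / (s * w * (s * w + q + r) ^+ 2)).
  by field; rewrite s00 w00 d00.
rewrite [X in X / _](_ : _ = 0) ?mul0r//.
(* The numerator is a combination of the two relations between the square roots, [s ^+ 2 = 2] and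
   [q ^+ 2 = r ^+ 2 + s ^+ 2 * w ^+ 2]. *)
transitivity ((2 - s ^+ 2) * 2 * (s * w + q) * r * w -
  s * r * (q ^+ 2 - (r ^+ 2 + s ^+ 2 * w ^+ 2))).
  by ring.
by rewrite qr s2; ring.
Qed.

Lemma profile_continuous : continuous (U a m).
Proof.
apply: glue_continuous.
- exact: is_derive_continuous is_derive_upper_profile.
- exact: is_derive_continuous is_derive_lower_profile.
- exact: etrans upper_profile0 (esym lower_profile0).
Qed.

End ProfileFacts.

(** * Touching from above in the plane *)

Section Lines.
Context {R : realType}.
Implicit Types (u : R * R -> R) (x y s r : R).

Lemma is_derive_e1 u x y : derivable u (x, y) e1 ->
  is_derive x 1 (fun z => u (z, y)) ('D_e1 u (x, y)).
Proof.
have E : (fun h : R => h^-1 *: ((u \o shift (x, y)) (h *: e1) - u (x, y))) =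
  (fun h => h^-1 *: (((fun z => u (z, y)) \o shift x) (h *: (1 : R)) - u (x, y))).
  apply/funext => h /=; congr (_ *: (u _ - _)).
  by rewrite -[LHS]/(h * 1 + x, h * 0 + y) mulr0 add0r.
move=> du; apply: DeriveDef; first by rewrite /derivable -E.
by rewrite /derive -E.
Qed.

Lemma is_derive_e2 u x y : derivable u (x, y) e2 ->
  is_derive y 1 (fun z => u (x, z)) ('D_e2 u (x, y)).
Proof.
have E : (fun h : R => h^-1 *: ((u \o shift (x, y)) (h *: e2) - u (x, y))) =
  (fun h => h^-1 *: (((fun z => u (x, z)) \o shift y) (h *: (1 : R)) - u (x, y))).
  apply/funext => h /=; congr (_ *: (u _ - _)).
  by rewrite -[LHS]/(h * 0 + x, h * 1 + y) mulr0 add0r.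
move=> du; apply: DeriveDef; first by rewrite /derivable -E.
by rewrite /derive -E.
Qed.

(** Second derivative test for [s * u - f] along a horizontal line. Taking [s = -1] covers functions
    touching [u] from below. *)
Lemma touch_e1 u x0 y s r (f f1 : R -> R) (f2 : R) : 0 < r ->
  (forall x, `|x - x0| < r -> derivable u (x, y) e1) ->
  derivable ('D_e1 u) (x0, y) e1 ->
  (forall x, `|x - x0| < r -> is_derive x 1 f (f1 x)) -> is_derive x0 1 f1 f2 ->
  (forall x, `|x - x0| < r -> s * u (x, y) <= f x) -> s * u (x0, y) = f x0 ->
  s * 'D_e1 ('D_e1 u) (x0, y) <= f2.
Proof.
move=> r0 du du' df df' uf uf0; rewrite -subr_le0.
apply: (@second_derivative_at_max _ (fun x => s * u (x, y) - f x)
  (fun x => s * 'D_e1 u (x, y) - f1 x) _ x0 r r0).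
- move=> x xr; apply: is_derive_sub; last exact: df.
  by apply/is_derive_scale/is_derive_e1/du.
- exact: (is_derive_sub (is_derive_scale s (is_derive_e1 du')) df').
- by move=> x xr; rewrite uf0 subrr subr_le0 uf.
Qed.

Lemma touch_e2 u x y0 s r (f f1 : R -> R) (f2 : R) : 0 < r ->
  (forall y, `|y - y0| < r -> derivable u (x, y) e2) ->
  derivable ('D_e2 u) (x, y0) e2 ->
  (forall y, `|y - y0| < r -> is_derive y 1 f (f1 y)) -> is_derive y0 1 f1 f2 ->
  (forall y, `|y - y0| < r -> s * u (x, y) <= f y) -> s * u (x, y0) = f y0 ->
  s * 'D_e2 ('D_e2 u) (x, y0) <= f2.
Proof.
move=> r0 du du' df df' uf uf0; rewrite -subr_le0.
apply: (@second_derivative_at_max _ (fun y => s * u (x, y) - f y)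
  (fun y => s * 'D_e2 u (x, y) - f1 y) _ y0 r r0).
- move=> y yr; apply: is_derive_sub; last exact: df.
  by apply/is_derive_scale/is_derive_e2/du.
- exact: (is_derive_sub (is_derive_scale s (is_derive_e2 du')) df').
- by move=> y yr; rewrite uf0 subrr subr_le0 uf.
Qed.

Lemma continuous_vline (w : R * R -> R) x : continuous w -> continuous (fun y => w (x, y)).
Proof.
move=> cw y; apply: (@continuous_comp _ _ _ (fun y => (x, y)) w); last exact: cw.
exact: (@cvg_pair R R R (nbhs y) (nbhs x) (nbhs y) _ _ _ (cst x) id (cvg_cst x) cvg_id).
Qed.

(** Compactness gives a maximum on the closed rectangle, and the value at [(x, y)] beats the whole
    boundary, so the maximum is interior. A neighbourhood of it is returned because the touching
    tests are local. *)
Lemma rectangle_max (F : R * R -> R) (x1 x2 y1 y2 x y : R) :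
  (forall x' y', x1 <= x' <= x2 -> y1 <= y' <= y2 -> {for (x', y'), continuous F}) ->
  x1 <= x <= x2 -> y1 <= y <= y2 ->
  (forall x' y', x1 <= x' <= x2 -> y1 <= y' <= y2 ->
     [\/ x' = x1, x' = x2, y' = y1 | y' = y2] -> F (x', y') < F (x, y)) ->
  exists x0 y0, [/\ x1 < x0 < x2, y1 < y0 < y2, F (x, y) <= F (x0, y0) &
    exists2 r, 0 < r & forall x' y', `|x' - x0| < r -> `|y' - y0| < r ->
      [/\ x1 <= x' <= x2, y1 <= y' <= y2 & F (x', y') <= F (x0, y0)]].
Proof.
move=> cF xX yY bF.
pose Q : set (R * R) := `[x1, x2] `*` `[y1, y2].
have QP p : Q p <-> x1 <= p.1 <= x2 /\ y1 <= p.2 <= y2 by rewrite /Q /= !in_itv.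
have [|||[x0 y0] q0 qmax] := @compact_EVT_max _ _ F Q.
- by exists (x, y); apply/QP.
- by apply: compact_setX; exact: segment_compact.
- by apply: continuous_in_subspaceT => -[x' y']; rewrite inE => /QP[]; exact: cF.
have [/= x0X y0Y] : x1 <= x0 <= x2 /\ y1 <= y0 <= y2 by apply/(QP (x0, y0)); rewrite inE in q0.
have Fq : F (x, y) <= F (x0, y0) by apply: qmax; rewrite inE; apply/QP.
have nb : ~ [\/ x0 = x1, x0 = x2, y0 = y1 | y0 = y2].
  by move=> /(bF _ _ x0X y0Y); rewrite ltNge Fq.
have x0gt : x1 < x0.
  rewrite lt_neqAle (andP x0X).1 andbT; apply/eqP => E; apply: nb; constructor 1.
  by rewrite E.
have x0lt : x0 < x2.
  by rewrite lt_neqAle (andP x0X).2 andbT; apply/eqP => E; apply: nb; constructor 2.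
have y0gt : y1 < y0.
  rewrite lt_neqAle (andP y0Y).1 andbT; apply/eqP => E; apply: nb; constructor 3.
  by rewrite E.
have y0lt : y0 < y2.
  by rewrite lt_neqAle (andP y0Y).2 andbT; apply/eqP => E; apply: nb; constructor 4.
exists x0, y0; split => //; [by rewrite x0gt|by rewrite y0gt|].
pose r := Num.min (Num.min (x0 - x1) (x2 - x0)) (Num.min (y0 - y1) (y2 - y0)).
exists r; first by rewrite !lt_min !subr_gt0 x0gt x0lt y0gt y0lt.
move=> x' y' x'r y'r.
have [r1 r2 r3 r4] : [/\ r <= x0 - x1, r <= x2 - x0, r <= y0 - y1 & r <= y2 - y0].
  by rewrite /r !ge_min !lexx !orbT.
have x'X : x1 <= x' <= x2 by move: x'r; rewrite ltr_norml; lra.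
have y'Y : y1 <= y' <= y2 by move: y'r; rewrite ltr_norml; lra.
by split => //; apply: qmax; rewrite inE; apply/QP.
Qed.

Lemma is_derive_prod (f g : R -> R) (c y df dg : R) :
  is_derive y 1 f df -> is_derive y 1 g dg ->
  is_derive y 1 (fun y => f y * (c + g y)) (df * (c + g y) + f y * dg).
Proof.
move=> hf hg; have h := is_derive_mul hf (is_derive_add (is_derive_const c y) hg).
by apply: is_derive_eq h _; ring.
Qed.

Lemma is_derive_parabola (p b d x : R) :
  is_derive x 1 (fun x => p * (b + d * x ^+ 2)) (p * (2 * d * x)).
Proof.
have h := is_derive_add (is_derive_const b x) (is_derive_scale d (is_derive_sqr x)).
by apply: is_derive_eq (is_derive_scale p h) _; ring.
Qed.

Lemma is_derive_line (p b x : R) : is_derive x 1 (fun x => p * (b * x)) (p * b).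
Proof.
have h := is_derive_scale p (is_derive_scale b (is_derive_var x)).
by apply: is_derive_eq h _; ring.
Qed.

Lemma near_gt (g : R * R -> R) (c x y : R) : {for (x, y), continuous g} -> c < g (x, y) ->
  exists2 e, 0 < e & forall x' y', `|x' - x| < e -> `|y' - y| < e -> c < g (x', y').
Proof.
move=> cg gc; have H := @cvgr_gt R _ _ (nbhs_filter ((x, y) : (R * R)%type)) g _ cg _ gc.
have [e /= e0 eP] := (@nbhs_ballP R (R * R)%type (x, y) _).1 H.
exists e => // x' y' xe ye.
by apply: eP; split; rewrite /ball /= distrC.
Qed.

Definition sqr_dist (x0 y0 x y : R) : R := (x - x0) ^+ 2 + (y - y0) ^+ 2.

Lemma sqr_dist_continuous x0 y0 : continuous (fun p : R * R => sqr_dist x0 y0 p.1 p.2).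
Proof.
move=> p; have c1 : (fun p : R * R => p.1 - x0) @ p --> p.1 - x0.
  by apply: cvgB; [exact: cvg_fst|exact: cvg_cst].
have c2 : (fun p : R * R => p.2 - y0) @ p --> p.2 - y0.
  by apply: cvgB; [exact: cvg_snd|exact: cvg_cst].
exact: (cvgD (cvgM c1 c1) (cvgM c2 c2)).
Qed.

Lemma is_derive_sqr_dist1 x0 y0 (x y : R) :
  is_derive x 1 (fun x => sqr_dist x0 y0 x y) (2 * (x - x0)).
Proof.
have h := is_derive_sub (is_derive_var x) (is_derive_const x0 x).
have h' := is_derive_add (is_derive_mul h h) (is_derive_const ((y - y0) ^+ 2) x).
by apply: is_derive_eq h' _; ring.
Qed.

Lemma is_derive_sqr_dist2 x0 y0 (x y : R) :
  is_derive y 1 (fun y => sqr_dist x0 y0 x y) (2 * (y - y0)).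
Proof.
have h := is_derive_sub (is_derive_var y) (is_derive_const y0 y).
have h' := is_derive_add (is_derive_const ((x - x0) ^+ 2) y) (is_derive_mul h h).
by apply: is_derive_eq h' _; ring.
Qed.

End Lines.

(** * Comparison with penalized profiles *)

(* [w] is the continuous representative of [u]: the two differ at most on the
   line x_2 = 0, where the values of [u] are arbitrary. *)
Record regular_solution (R : realType) (a m : R) (u w : R * R -> R) : Prop := {
  rs_solution : transmission_solution a m u;
  rs_continuous : continuous w;
  rs_eq : forall x y, y != 0 -> w (x, y) = u (x, y);
  rs_ge0 : forall p, 0 <= w p;
  rs_bounded : exists B, forall p, w p <= B;
  rs_derivable1 : forall x y, y != 0 -> derivable u (x, y) e1;
  rs_derivable2 : forall x y, y != 0 -> derivable u (x, y) e2;
  rs_derivable11 : forall x y, y != 0 -> derivable ('D_e1 u) (x, y) e1;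
  rs_derivable22 : forall x y, y != 0 -> derivable ('D_e2 u) (x, y) e2 }.

(** * Inequalities at a point of contact with a penalized profile *)

Section Contact.
Context {R : realType}.
Variables (a m : R) (u w : R * R -> R).
Hypotheses (ha : 0 < a) (hm : 0 < m) (S : regular_solution a m u w).

Let sol := rs_solution S.
Let w_cont := rs_continuous S.
Let wE := rs_eq S.
Let du1 := rs_derivable1 S.
Let du2 := rs_derivable2 S.
Let du11 := rs_derivable11 S.
Let du22 := rs_derivable22 S.

Local Notation V := (upper_profile a m).
Local Notation V' := (upper_profile' a m).
Local Notation E := (lower_profile a m).
Local Notation A := (amplitude a m).
Local Notation kappa := (decay_rate a m).

Variables (kp kp1 kp2 km km1 km2 : R -> R) (s M d : R).
Hypothesis (dkp : forall y : R, is_derive y 1 kp (kp1 y)).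
Hypothesis (dkp1 : forall y : R, is_derive y 1 kp1 (kp2 y)).
Hypothesis (dkm : forall y : R, is_derive y 1 km (km1 y)).
Hypothesis (dkm1 : forall y : R, is_derive y 1 km1 (km2 y)).
Hypothesis (k0 : kp 0 = km 0).

Let penalty (x y : R) := d * x ^+ 2 + (if 0 <= y then kp y else km y).

Let eq_leW (x y : R) : x = y -> x <= y.
Proof. by move=> ->. Qed.

(** With [g = M + penalty], the function [U * g] touches [s * w] from above, so off the interface
    [Lap (s u) <= Lap (U g)] there. Expanding the right-hand side, the term [U'' g] combines with
    the equation for [s u] into the cubic expression above the interface and cancels it below;
    dividing by [U] gives the first two claims. On the interface one-sided first derivatives are
    compared instead. *)
Lemma contact (x0 y0 r : R) : s = 1 \/ s = -1 -> 0 < r ->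
  (forall x y, `|x - x0| < r -> `|y - y0| < r ->
     s * w (x, y) <= U a m y * (M + penalty x y)) ->
  s * w (x0, y0) = U a m y0 * (M + penalty x0 y0) ->
  [/\ 0 < y0 -> V y0 ^+ 2 * ((M + penalty x0 y0) * ((M + penalty x0 y0) ^+ 2 - 1)) <=
         2 * d + 2 * (V' y0 / V y0) * kp1 y0 + kp2 y0,
      y0 < 0 -> 0 <= 2 * d + 2 * kappa * km1 y0 + km2 y0
    & y0 = 0 -> m^-1 * km1 0 <= kp1 0].
Proof.
move=> s1 r0 wle weq.
have s2 : s ^+ 2 = 1 by case: s1 => ->; rewrite ?expr1n ?sqrrN ?expr1n.
split.
- move=> y0_gt0.
  have v0 : 0 < V y0 by rewrite upper_profile_gt0// ltW.
  pose f x := V y0 * ((M + kp y0) + d * x ^+ 2).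
  have h1 : s * 'D_e1 ('D_e1 u) (x0, y0) <= V y0 * (2 * d).
    refine (@touch_e1 _ u x0 y0 s r f (fun x => V y0 * (2 * d * x)) _ r0 _ _ _ _ _ _).
    + by move=> *; apply: du1; rewrite gt_eqF.
    + by apply: du11; rewrite gt_eqF.
    + by move=> x _; exact: is_derive_parabola.
    + exact: is_derive_line.
    + move=> x xr; rewrite -wE ?gt_eqF// (le_trans (wle _ _ _ _))// ?subrr ?normr0//.
      by rewrite UE /penalty (ltW y0_gt0) /f [d * _ + _]addrC addrA.
    + rewrite -wE ?gt_eqF// weq UE /penalty (ltW y0_gt0) /f.
      by rewrite [d * _ + _]addrC addrA.
  pose c := M + d * x0 ^+ 2.
  have h2 : s * 'D_e2 ('D_e2 u) (x0, y0) <=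
     - ((1 - V y0 ^+ 2) * V y0) * (c + kp y0) + 2 * V' y0 * kp1 y0 + V y0 * kp2 y0.
    have r'0 : 0 < Num.min r y0 by rewrite lt_min r0.
    have near_y0 y : `|y - y0| < Num.min r y0 -> 0 < y /\ `|y - y0| < r.
      by rewrite lt_min => /andP[yr]; rewrite ltr_norml; lra.
    refine (@touch_e2 _ u x0 y0 s (Num.min r y0) (fun y => V y * (c + kp y))
      (fun y => V' y * (c + kp y) + V y * kp1 y) _ r'0 _ _ _ _ _ _).
    + by move=> y /near_y0[y_gt0 _]; apply: du2; rewrite gt_eqF.
    + by apply: du22; rewrite gt_eqF.
    + by move=> y _; exact: (is_derive_prod c (is_derive_upper_profile ha hm y) (dkp y)).
    + have h := is_derive_add (is_derive_prod c (is_derive_upper_profile' ha hm y0) (dkp y0))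
        (is_derive_mul (is_derive_upper_profile ha hm y0) (dkp1 y0)).
      by apply: is_derive_eq h _; ring.
    + move=> y /near_y0[y_gt0 yr]; rewrite -wE ?gt_eqF//.
      rewrite (le_trans (wle _ _ _ _))// ?subrr ?normr0//.
      by rewrite UE /penalty (ltW y_gt0) /c addrA.
    + by rewrite -wE ?gt_eqF// weq UE /penalty (ltW y0_gt0) /c addrA.
  have [/(_ (x0, y0) y0_gt0) sol1 _ _ _] := sol.
  have eq0 : s * u (x0, y0) = V y0 * (c + kp y0).
    by rewrite -wE ?gt_eqF// weq UE /penalty (ltW y0_gt0) /c addrA.
  have -> : M + penalty x0 y0 = c + kp y0 by rewrite /penalty (ltW y0_gt0) /c addrA.
  rewrite -(ler_pM2l v0).
  have -> : V y0 * (2 * d + 2 * (V' y0 / V y0) * kp1 y0 + kp2 y0) =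
    V y0 * (2 * d) + 2 * V' y0 * kp1 y0 + V y0 * kp2 y0 by field; rewrite gt_eqF.
  have : - ((1 - (s * u (x0, y0)) ^+ 2) * (s * u (x0, y0))) =
      s * 'D_e1 ('D_e1 u) (x0, y0) + s * 'D_e2 ('D_e2 u) (x0, y0).
    have lapE : 'D_e1 ('D_e1 u) (x0, y0) + 'D_e2 ('D_e2 u) (x0, y0) =
        - ((1 - u (x0, y0) ^+ 2) * u (x0, y0)) by rewrite -sol1 opprK.
    by rewrite exprMn s2 mul1r -mulrDr lapE; ring.
  rewrite eq0 => lap.
  (* With [g = c + kp y0], this is [Lap (s u) - V'' g]. *)
  have -> : V y0 * (V y0 ^+ 2 * ((c + kp y0) * ((c + kp y0) ^+ 2 - 1))) =
   - ((1 - (V y0 * (c + kp y0)) ^+ 2) * (V y0 * (c + kp y0)))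
   + (1 - V y0 ^+ 2) * V y0 * (c + kp y0) by ring.
  rewrite lap -lerBrDr; apply: (le_trans (lerD h1 h2)).
  by apply/eq_leW; ring.
- move=> y0_lt0.
  have y0_ge0 : (0 <= y0) = false by apply/negbTE; rewrite -ltNge.
  have v0 : 0 < E y0 by exact: lower_profile_gt0.
  pose f x := E y0 * ((M + km y0) + d * x ^+ 2).
  have h1 : s * 'D_e1 ('D_e1 u) (x0, y0) <= E y0 * (2 * d).
    refine (@touch_e1 _ u x0 y0 s r f (fun x => E y0 * (2 * d * x)) _ r0 _ _ _ _ _ _).
    + by move=> *; apply: du1; rewrite lt_eqF.
    + by apply: du11; rewrite lt_eqF.
    + by move=> x _; exact: is_derive_parabola.
    + exact: is_derive_line.
    + move=> x xr; rewrite -wE ?lt_eqF// (le_trans (wle _ _ _ _))// ?subrr ?normr0//.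
      by rewrite UE /penalty y0_ge0 /f [d * _ + _]addrC addrA.
    + rewrite -wE ?lt_eqF// weq UE /penalty y0_ge0 /f.
      by rewrite [d * _ + _]addrC addrA.
  pose c := M + d * x0 ^+ 2.
  have h2 : s * 'D_e2 ('D_e2 u) (x0, y0) <=
     kappa ^+ 2 * E y0 * (c + km y0) + 2 * (kappa * E y0) * km1 y0 + E y0 * km2 y0.
    have r'0 : 0 < Num.min r (- y0) by rewrite lt_min r0; lra.
    have near_y0 y : `|y - y0| < Num.min r (- y0) -> y < 0 /\ `|y - y0| < r.
      by rewrite lt_min => /andP[yr]; rewrite ltr_norml; lra.
    refine (@touch_e2 _ u x0 y0 s (Num.min r (- y0)) (fun y => E y * (c + km y))
      (fun y => kappa * E y * (c + km y) + E y * km1 y) _ r'0 _ _ _ _ _ _).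
    + by move=> y /near_y0[y_lt0 _]; apply: du2; rewrite lt_eqF.
    + by apply: du22; rewrite lt_eqF.
    + by move=> y _; exact: (is_derive_prod c (is_derive_lower_profile a m y) (dkm y)).
    + have dE := is_derive_lower_profile a m y0.
      have h := is_derive_add (is_derive_prod c (is_derive_scale kappa dE) (dkm y0))
        (is_derive_mul dE (dkm1 y0)).
      by apply: is_derive_eq h _; ring.
    + move=> y /near_y0[y_lt0 yr]; rewrite -wE ?lt_eqF//.
      rewrite (le_trans (wle _ _ _ _))// ?subrr ?normr0//.
      by rewrite UE /penalty (lt_geF y_lt0) /c addrA.
    + by rewrite -wE ?lt_eqF// weq UE /penalty y0_ge0 /c addrA.
  have : 'D_e1 ('D_e1 u) (x0, y0) + 'D_e2 ('D_e2 u) (x0, y0) = a * m * u (x0, y0).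
    have [_ /(_ (x0, y0) y0_lt0) + _ _] := sol.
    move=> /oppr_inj /(congr1 (fun z => m * z)).
    by rewrite /= mulVKf ?gt_eqF// /laplacian => ->; ring.
  move=> /(congr1 (fun z => s * z)); rewrite mulrDr => lap.
  have eq0 : s * u (x0, y0) = E y0 * (c + km y0).
    by rewrite -wE ?lt_eqF// weq UE /penalty y0_ge0 /c addrA.
  rewrite -(pmulr_rge0 _ v0).
  have : s * (a * m * u (x0, y0)) = kappa ^+ 2 * (E y0 * (c + km y0)).
    by rewrite sqr_decay_rate// -eq0; ring.
  move=> lapE; have := lerD h1 h2; rewrite lap lapE -subr_ge0 => h.
  by apply: (le_trans h); apply/eq_leW; ring.
- move=> y0E; rewrite {y0}y0E in wle weq *.
  have [_ _ tr _] := sol; have [l lr ll] := tr x0.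
  pose c := M + d * x0 ^+ 2.
  have A0 := amplitude_gt0 ha hm.
  have weq' : s * w (x0, 0) = A * (c + kp 0).
    by rewrite weq UE lexx upper_profile0// /penalty lexx /c addrA.
  have cw := @continuous_vline _ w x0 w_cont.
  have cV := is_derive_continuous (is_derive_upper_profile ha hm).
  have cV' := is_derive_continuous (is_derive_upper_profile' ha hm).
  have cE := is_derive_continuous (is_derive_lower_profile a m).
  have hr : s * (m^-1 * l) - (V' 0 * (c + kp 0) + V 0 * kp1 0) <= 0.
    apply: (@right_derivative_at_max _ (fun y => s * w (x0, y) - V y * (c + kp y))
      (fun y => s * 'D_e2 u (x0, y) - (V' y * (c + kp y) + V y * kp1 y)) _ r r0).
    + apply: cvg_at_right_filter; apply: cvgB; first by apply: cvgM; [exact: cvg_cst|exact: cw].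
      apply: cvgM; first exact: cV.
      by apply: cvgD; [exact: cvg_cst|exact: (is_derive_continuous dkp)].
    + move=> y /andP[y_gt0 _].
      have yn0 : y != 0 by rewrite gt_eqF.
      have h := is_derive_sub (is_derive_scale s (is_derive_e2 (@du2 x0 y yn0)))
        (is_derive_prod c (is_derive_upper_profile ha hm y) (dkp y)).
      apply: near_eq_is_derive h.
      near=> z; rewrite -wE// gt_eqF//.
      by near: z; exact: lt_nbhsr.
    + apply: cvgB; first by apply: cvgM; [exact: cvg_cst|].
      apply: cvg_at_right_filter; apply: cvgD; apply: cvgM; first exact: cV'.
      * by apply: cvgD; [exact: cvg_cst|exact: (is_derive_continuous dkp)].
      * exact: cV.
      * exact: (is_derive_continuous dkp1).
    + move=> y /andP[y_gt0 yr]; rewrite weq' upper_profile0// subrr subr_le0.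
      rewrite (le_trans (wle _ _ _ _))// ?subrr ?normr0// ?subr0 ?gtr0_norm//.
      by rewrite UE /penalty (ltW y_gt0) /c addrA.
  have hl : 0 <= s * l - (kappa * E 0 * (c + km 0) + E 0 * km1 0).
    apply: (@left_derivative_at_max _ (fun y => s * w (x0, y) - E y * (c + km y))
      (fun y => s * 'D_e2 u (x0, y) - (kappa * E y * (c + km y) + E y * km1 y)) _ r r0).
    + apply: cvg_at_left_filter; apply: cvgB; first by apply: cvgM; [exact: cvg_cst|exact: cw].
      apply: cvgM; first exact: cE.
      by apply: cvgD; [exact: cvg_cst|exact: (is_derive_continuous dkm)].
    + move=> y /andP[_ y_lt0].
      have yn0 : y != 0 by rewrite lt_eqF.
      have h := is_derive_sub (is_derive_scale s (is_derive_e2 (@du2 x0 y yn0)))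
        (is_derive_prod c (is_derive_lower_profile a m y) (dkm y)).
      apply: near_eq_is_derive h.
      near=> z; rewrite -wE// lt_eqF//.
      by near: z; exact: lt_nbhsl.
    + apply: cvgB; first by apply: cvgM; [exact: cvg_cst|].
      apply: cvg_at_left_filter; apply: cvgD; apply: cvgM.
      * by apply: cvgM; [exact: cvg_cst|exact: cE].
      * by apply: cvgD; [exact: cvg_cst|exact: (is_derive_continuous dkm)].
      * exact: cE.
      * exact: (is_derive_continuous dkm1).
    + move=> y /andP[yr y_lt0]; rewrite weq' lower_profile0// k0 subrr subr_le0.
      rewrite (le_trans (wle _ _ _ _))// ?subrr ?normr0// ?subr0 ?ltr0_norm//;
        first by rewrite ltrNl.
      by rewrite UE /penalty (lt_geF y_lt0) /c addrA.
  move: hr hl; rewrite upper_profile0// upper_profile'0// lower_profile0// k0 => hr hl.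
  (* After division by [m] the terms in [l] cancel by the transmission condition and those in [V' 0]
     by the flux balance of the profile; only the slopes of the penalty remain. *)
  have : 0 <= m^-1 * (s * l - (kappa * A * (c + km 0) + A * km1 0)).
    by rewrite mulr_ge0// invr_ge0 ltW.
  move=> /(le_trans hr); rewrite -subr_ge0 => h.
  rewrite -(ler_pM2l A0) -subr_ge0; apply: (le_trans h).
  by apply/eq_leW; ring.
Unshelve. all: by end_near. Qed.

End Contact.

(** * Barriers, and the location of penalized extrema *)

Section Comparison.
Context {R : realType}.
Variables (a m : R) (u w : R * R -> R).
Hypotheses (ha : 0 < a) (hm : 0 < m) (S : regular_solution a m u w).

Local Notation V := (upper_profile a m).
Local Notation V' := (upper_profile' a m).
Local Notation kappa := (decay_rate a m).

(* At the rate [lam] the function exp (- lam y) outgrows the decay of the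
   profile below the interface and is still a strict supersolution there. *)
Definition barrier_rate := 3 / 2 * kappa.
(** Small for two reasons: [2 * delta] must stay below the gain [lam * (2 * kappa - lam) = 3 / 4 *
    kappa ^+ 2] of the exponential, and [delta < 1] lets a term [- y ^+ 2] outweigh [delta * x ^+ 2]
    in the Laplacian. *)
Definition barrier_weight := kappa ^+ 2 / (4 * (1 + kappa ^+ 2)).

Local Notation lam := barrier_rate.
Local Notation delta := barrier_weight.

Let kappa0 : 0 < kappa := decay_rate_gt0 ha hm.
Let sqr_kappa0 : 0 < kappa ^+ 2. Proof. by rewrite exprn_gt0. Qed.

Lemma barrier_rate_gt0 : 0 < lam.
Proof. by rewrite mulr_gt0//; lra. Qed.

Lemma barrier_weight_gt0 : 0 < delta.
Proof. by rewrite divr_gt0// mulr_gt0//; move: sqr_kappa0; lra. Qed.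

Lemma barrier_weight_lt1 : delta < 1.
Proof. by rewrite ltr_pdivrMr ?mulr_gt0//; move: sqr_kappa0; lra. Qed.

Lemma barrier_weight_lt : 2 * delta < 3 / 4 * kappa ^+ 2.
Proof.
rewrite /barrier_weight mulrA ltr_pdivrMr; last by rewrite mulr_gt0//; move: sqr_kappa0; lra.
by move: (kappa ^+ 2) sqr_kappa0 => k k2; have := mulr_gt0 k2 k2; lra.
Qed.

(** The shift [K - 1] makes the two branches agree at [y = 0] when [f 0 = K]. The upper branch is a
    parameter because the upper and lower bounds call for different ones. *)
Definition barrier (K : R) (f : R -> R) (x y : R) : R :=
  delta * x ^+ 2 + (if 0 <= y then f y else expR (- (lam * y)) + (K - 1)).

Definition ratio (x y : R) : R := w (x, y) / U a m y.

Let is_derive_decay (e c y : R) :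
  is_derive y 1 (fun y => e * (expR (- (lam * y)) + c)) (e * (- lam * expR (- (lam * y)))).
Proof.
have h : is_derive y 1 (fun y : R => - (lam * y)) (- lam).
  have h := is_derive_scale (- lam) (is_derive_var y).
  have <- : (fun y : R => - lam * y) = (fun y => - (lam * y)).
    by apply/funext => z; rewrite mulNr.
  by apply: is_derive_eq h _; rewrite mulr1.
have h' := is_derive1_comp (is_derive_expR _) h.
have h'' := is_derive_scale e (is_derive_add h' (is_derive_const c y)).
by apply: is_derive_eq h'' _; ring.
Qed.

(** The penalized ratio has an interior maximum, to which [contact] applies. Below the interface the
    exponential branch is a strict supersolution; on it, the barrier has slopes [f1 0] above and
    [- lam] below, and the bound on [f1 0] contradicts the contact inequality. *)
Lemma comparison (s eps K X Y T x y : R) (f f1 f2 : R -> R) :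
  s = 1 \/ s = -1 -> 0 < eps ->
  (forall t : R, is_derive t 1 f (f1 t)) -> (forall t : R, is_derive t 1 f1 (f2 t)) ->
  f 0 = K -> f1 0 < - (m^-1 * lam) ->
  `|x| <= X -> - Y <= y <= T ->
  (forall x' y' : R, `|x'| <= X -> - Y <= y' <= T -> [\/ `|x'| = X, y' = - Y | y' = T] ->
     s * ratio x' y' - eps * barrier K f x' y' < s * ratio x y - eps * barrier K f x y) ->
  exists x0 y0, [/\ 0 < y0 < T,
    s * ratio x y - eps * barrier K f x y <= s * ratio x0 y0 - eps * barrier K f x0 y0 &
    V y0 ^+ 2 * (s * ratio x0 y0 * ((s * ratio x0 y0) ^+ 2 - 1)) <=
      eps * (2 * delta + 2 * (V' y0 / V y0) * f1 y0 + f2 y0)].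
Proof.
move=> s1 eps0 df df1 f0 kink xX yY bF.
pose F (p : R * R) := s * ratio p.1 p.2 - eps * barrier K f p.1 p.2.
have cF : continuous F.
  have -> : F = fun p => s * (w p / U a m p.2) - eps * barrier K f p.1 p.2.
    by apply/funext => -[].
  move=> p; apply: cvgB.
    apply: cvgM; first exact: cvg_cst.
    apply: cvgM; first exact: (rs_continuous S).
    apply: cvgV; first by rewrite gt_eqF ?U_gt0.
    by apply: (continuous_comp (@cvg_snd _ _ _ _ _)); exact: profile_continuous.
  apply: cvgM; first exact: cvg_cst.
  apply: cvgD.
    apply: cvgM; first exact: cvg_cst.
    by apply: cvgM; exact: cvg_fst.
  have ck : continuous (fun y : R => if 0 <= y then f y else expR (- (lam * y)) + (K - 1)).
    apply: glue_continuous; first exact: is_derive_continuous df.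
      have -> : (fun y => expR (- (lam * y)) + (K - 1)) =
          (fun y => 1 * (expR (- (lam * y)) + (K - 1))).
        by apply/funext => z; rewrite mul1r.
      exact: is_derive_continuous (is_derive_decay 1 (K - 1)).
    by rewrite mulr0 oppr0 expR0 f0 addrC subrK.
  exact: (@continuous_comp _ _ _ snd _ p cvg_snd (ck p.2)).
have xX' : - X <= x <= X by rewrite -ler_norml.
have [||x0 [y0 [x0X y0Y]]] := @rectangle_max _ F (- X) X (- Y) T x y _ xX' yY.
- by move=> *; exact: cF.
- move=> x' y'; rewrite -ler_norml => x'X y'Y b; apply: bF => //.
  have X0 : 0 <= X by rewrite (le_trans _ xX).
  by case: b => [->|->|->|->]; [constructor 1|constructor 1|constructor 2|constructor 3];
    rewrite ?normrN ?ger0_norm.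
rewrite {1}/F/= => Fxy [r r0 Fmax].
pose M := F (x0, y0).
have pE x' y' : eps * barrier K f x' y' = eps * delta * x' ^+ 2 +
    (if 0 <= y' then eps * f y' else eps * (expR (- (lam * y')) + (K - 1))).
  by rewrite /barrier; case: ifP => _; ring.
have swE x' y' : s * w (x', y') = U a m y' * (s * ratio x' y').
  by rewrite /ratio; field; rewrite gt_eqF ?U_gt0.
have MF x' y' : s * ratio x' y' = F (x', y') + eps * barrier K f x' y' by rewrite subrK.
have ddecay (t : R) : is_derive t 1 (fun y => eps * (- lam * expR (- (lam * y))))
    (eps * (lam ^+ 2 * expR (- (lam * t)))).
  have h := is_derive_scale (- lam) (is_derive_decay eps 0 t).
  have <- : (fun y => - lam * (eps * (expR (- (lam * y)) + 0))) =
      (fun y => eps * (- lam * expR (- (lam * y)))) by apply/funext => z; ring.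
  by apply: is_derive_eq h _; ring.
have k00 : eps * f 0 = eps * (expR (- (lam * 0)) + (K - 1)).
  by rewrite mulr0 oppr0 expR0 f0 addrC subrK.
(* Since [M] is the maximum of [F], the barrier raised by [M] touches [s * ratio] from above;
   multiplying by [U] puts this in the form of [contact]. *)
have wle x' y' : `|x' - x0| < r -> `|y' - y0| < r -> s * w (x', y') <=
    U a m y' * (M + (eps * delta * x' ^+ 2 +
      (if 0 <= y' then eps * f y' else eps * (expR (- (lam * y')) + (K - 1))))).
  move=> x'r y'r; rewrite -pE swE ler_pM2l ?U_gt0// MF lerD2r.
  by have [_ _] := Fmax _ _ x'r y'r.
have weq : s * w (x0, y0) = U a m y0 * (M + (eps * delta * x0 ^+ 2 +
    (if 0 <= y0 then eps * f y0 else eps * (expR (- (lam * y0)) + (K - 1))))).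
  by rewrite -pE swE MF.
have [c1 c2 c3] := contact ha hm S (fun y => is_derive_scale eps (df y))
  (fun y => is_derive_scale eps (df1 y)) (is_derive_decay eps (K - 1)) ddecay k00 s1 r0 wle weq.
have y0_gt0 : 0 < y0.
  case: (ltgtP y0 0) => // [y0_lt0|y00].
  (* The exponential contributes [lam ^+ 2 - 2 * kappa * lam = - 3 / 4 * kappa ^+ 2] times [e], and
     [e >= 1] below the interface. *)
  - have := c2 y0_lt0; set e := expR _; suff : 2 * delta < 3 / 4 * kappa ^+ 2 * e.
      move=> h1 h2; suff : 0 <= eps * (2 * delta - 3 / 4 * kappa ^+ 2 * e).
        by rewrite pmulr_rge0//; lra.
      by apply: (le_trans h2); rewrite le_eqVlt; apply/orP; left; apply/eqP;
        rewrite /barrier_rate; field.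
    have e1 : 1 <= e.
      by rewrite -[leLHS](@expR0 R) ler_expR oppr_ge0 pmulr_rle0 ?barrier_rate_gt0//; exact: ltW.
    by rewrite (lt_le_trans barrier_weight_lt)// ler_peMr// mulr_ge0 ?sqr_ge0// divr_ge0.
  - have := c3 y00; rewrite mulr0 oppr0 expR0 mulr1 mulrCA ler_pM2l//.
    by rewrite mulrN leNgt kink.
exists x0, y0; split; [by rewrite y0_gt0; case/andP: y0Y|exact: Fxy|].
have := c1 y0_gt0; rewrite -pE /M -MF => h; apply: (le_trans h).
by rewrite le_eqVlt; apply/orP; left; apply/eqP; ring.
Qed.

End Comparison.

(** * Upper bound by the profile *)

Section Bounds.
Context {R : realType}.
Variables (a m : R) (u w : R * R -> R).
Hypotheses (ha : 0 < a) (hm : 0 < m) (S : regular_solution a m u w).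

Local Notation V := (upper_profile a m).
Local Notation V' := (upper_profile' a m).
Local Notation A := (amplitude a m).
Local Notation kappa := (decay_rate a m).
Local Notation lam := (barrier_rate a m).
Local Notation delta := (barrier_weight a m).
Local Notation barrier := (barrier a m).
Local Notation ratio := (ratio a m w).

Let A0 : 0 < A := amplitude_gt0 ha hm.
Let kappa0 : 0 < kappa := decay_rate_gt0 ha hm.
Let lam0 : 0 < lam := barrier_rate_gt0 ha hm.
Let delta0 : 0 < delta := barrier_weight_gt0 ha hm.

Lemma barrier_lower K f x y : y < 0 ->
  barrier K f x y = delta * x ^+ 2 + (expR (- (lam * y)) + (K - 1)).
Proof. by move=> y0; rewrite /barrier (lt_geF y0). Qed.

Lemma barrier_upper K f x y : 0 <= y -> barrier K f x y = delta * x ^+ 2 + f y.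
Proof. by move=> y0; rewrite /barrier y0. Qed.

Lemma barrier_lower_ge K f (x y : R) : 1 <= K -> y < 0 ->
  delta * x ^+ 2 + - (lam * y) <= barrier K f x y.
Proof.
move=> K1 y0; rewrite barrier_lower// lerD2l.
by have := expR_ge1Dx (- (lam * y)); lra.
Qed.

Lemma barrier_ge0 K f (x y : R) : 1 <= K -> (0 <= y -> 0 <= f y) -> 0 <= barrier K f x y.
Proof.
move=> K1 f0; have dx : 0 <= delta * x ^+ 2 by rewrite mulr_ge0 ?sqr_ge0// ltW.
have [y0|y0] := leP 0 y; first by rewrite barrier_upper// addr_ge0 ?f0.
apply: le_trans (barrier_lower_ge _ _ K1 y0); rewrite addr_ge0//.
by rewrite oppr_ge0 pmulr_rle0// ltW.
Qed.

Lemma ratioE x y : w (x, y) = ratio x y * U a m y.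
Proof. by rewrite /ratio divfK// gt_eqF ?U_gt0. Qed.

Lemma ratio_ge0 x y : 0 <= ratio x y.
Proof. by rewrite divr_ge0 ?(rs_ge0 S)// ltW ?U_gt0. Qed.

(** The growth [exp (- kappa y)] is written as a square because [exp (- lam y)] is the cube of the
    same exponential [z]: ratio against barrier becomes [z ^+ 2] against [z ^+ 3]. *)
Lemma ratio_bound : exists2 W, 0 <= W & forall x y,
  (0 <= y -> ratio x y <= W) /\
  (y < 0 -> ratio x y <= W * expR (- (kappa * y) / 2) ^+ 2).
Proof.
have [B wB] := rs_bounded S.
have B0 : 0 <= B by rewrite (le_trans (rs_ge0 S (0, 0))).
exists (B / A) => [|x y]; first by rewrite divr_ge0// ltW.
split=> y0.
  rewrite /ratio UE y0 ler_pdivrMr ?upper_profile_gt0// (le_trans (wB _))//.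
  by rewrite mulrAC ler_pdivlMr// ler_wpM2l ?upper_profile_ge.
rewrite /ratio UE (lt_geF y0) ler_pdivrMr ?lower_profile_gt0// (le_trans (wB _))//.
rewrite -expRM_natr divfK// expRN /lower_profile.
by rewrite mulrACA mulVf ?gt_eqF ?expR_gt0// mulr1 divfK// gt_eqF.
Qed.

Lemma profile_log_derivative_bounds y : 0 <= y -> 0 <= V' y / V y <= A^-1.
Proof.
move=> y0; have vA := upper_profile_ge ha hm y0; have v1 := upper_profile_lt1 ha hm y.
have v0 : 0 < V y by apply: lt_le_trans vA.
have s0 : 1 < Num.sqrt 2 :> R by rewrite -[ltLHS]sqrtr1 ltr_sqrt//; lra.
have v'0 : 0 <= V' y <= 1.
  rewrite /upper_profile' divr_ge0 ?ler_pdivrMr; try nra.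
apply/andP; split; first by rewrite divr_ge0 ?(andP v'0).1// ltW.
rewrite ler_pdivrMr// mulrC ler_pdivlMr//.
by rewrite (le_trans _ vA)// ler_piMl ?(andP v'0).2// ltW.
Qed.

(** On the top side the linear growth of [f] absorbs [W]. Below the interface the cube absorbs the
    square once [z >= W / eps], which [Y] guarantees on the bottom side; while [z < W / eps] the
    ratio is at most [W * (W / eps) ^+ 2], which [X] lets the parabola absorb on the lateral
    sides. *)
Lemma penalized_ratio_le0 (W eps K X Y T x' y' : R) (f : R -> R) :
  0 <= W -> 0 < eps -> 1 <= K -> (forall t : R, t <= f t) -> 0 < Y -> 0 < T ->
  W + W * (W / eps) ^+ 2 <= eps * (delta * X ^+ 2) ->
  2 * (W / eps) / kappa <= Y -> W / eps <= T ->
  (0 <= y' -> ratio x' y' <= W) ->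
  (y' < 0 -> ratio x' y' <= W * expR (- (kappa * y') / 2) ^+ 2) ->
  [\/ `|x'| = X, y' = - Y | y' = T] ->
  ratio x' y' - eps * barrier K f x' y' <= 0.
Proof.
move=> W0 eps0 K1 fge Y0 T0 edX YW TW Wu Wl bd; rewrite subr_le0.
have WWe : 0 <= W * (W / eps) ^+ 2 by rewrite mulr_ge0// sqr_ge0.
have We0 : 0 <= W / eps by rewrite divr_ge0// ltW.
have dx' : 0 <= delta * x' ^+ 2 by rewrite mulr_ge0 ?sqr_ge0// ltW.
have [y'0|y'0] := leP 0 y'.
  rewrite (le_trans (Wu y'0))//.
  have h : eps * (delta * x' ^+ 2 + y') <= eps * barrier K f x' y'.
    by rewrite ler_pM2l// barrier_upper// lerD2l.
  apply: le_trans h; rewrite mulrDr.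
  have ey : 0 <= eps * y' by rewrite mulr_ge0// ltW.
  have ex : 0 <= eps * (delta * x' ^+ 2) by rewrite mulr_ge0// ltW.
  case: bd => [x'E|y'E|y'E].
  + by rewrite -[x' ^+ 2]real_normK ?num_real// x'E; lra.
  + by move: y'0; rewrite y'E; lra.
  + have : eps * (W / eps) <= eps * y' by rewrite ler_pM2l// y'E.
    by rewrite mulrC divfK ?gt_eqF//; lra.
rewrite (le_trans (Wl y'0))//; set z := expR _.
have z3 : expR (- (lam * y')) = z ^+ 3.
  by rewrite /z -expRM_natr /barrier_rate; congr expR; field.
have z0 : 0 < z by exact: expR_gt0.
have h : eps * (delta * x' ^+ 2 + z ^+ 3) <= eps * barrier K f x' y'.
  by rewrite ler_pM2l// barrier_lower// lerD2l z3; lra.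
apply: le_trans h; rewrite mulrDr.
have ex : 0 <= eps * (delta * x' ^+ 2) by rewrite mulr_ge0// ltW.
have zbig : W / eps <= z -> W * z ^+ 2 <= eps * z ^+ 3.
  rewrite ler_pdivrMr// => Wz; have -> : eps * z ^+ 3 = z * eps * z ^+ 2 by ring.
  by rewrite ler_wpM2r ?sqr_ge0.
have [/zbig zz|zs] := leP (W / eps) z; first lra.
case: bd => [x'E|y'E|y'E].
+ rewrite -[x' ^+ 2]real_normK ?num_real// x'E.
  have : W * z ^+ 2 <= W * (W / eps) ^+ 2.
    by rewrite ler_wpM2l// ler_sqr ?nnegrE ?(ltW zs)// ltW.
  have : 0 <= eps * z ^+ 3 by rewrite mulr_ge0 ?exprn_ge0// ltW.
  lra.
+ move: zs; rewrite ltNge => /negP; case; rewrite /z.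
  apply: le_trans (expR_ge1Dx _); rewrite y'E mulrN opprK.
  have : kappa * (2 * (W / eps) / kappa) <= kappa * Y by rewrite ler_pM2l.
  by rewrite [leLHS]mulrC divfK ?gt_eqF//; lra.
+ by move: y'0; rewrite y'E; lra.
Qed.

Lemma cubic_ge (eta g : R) : 0 <= eta -> 1 + eta <= g -> 2 * eta <= g * (g ^+ 2 - 1).
Proof.
move=> eta0 g1; have -> : g * (g ^+ 2 - 1) = g * (g + 1) * (g - 1) by ring.
have g2 : 1 * 2 <= g * (g + 1) by apply: ler_pM => //; lra.
by rewrite mul1r in g2; apply: ler_pM => //; lra.
Qed.

(** If the ratio exceeds 1 somewhere by [2 * eta], then at the penalized maximum the cubic term is
    at least [2 * A ^+ 2 * eta], while the penalty contributes at most [eps * C]. *)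
Lemma le_profile x y : w (x, y) <= U a m y.
Proof.
rewrite leNgt; apply/negP => wU.
have [W W0 Wb] := ratio_bound.
have q1 : 1 < ratio x y by rewrite /ratio ltr_pdivlMr ?U_gt0// mul1r.
pose eta := (ratio x y - 1) / 2.
have eta0 : 0 < eta by rewrite divr_gt0// subr_gt0.
(* The slope of [f] at 0 is [1 - K = - 1 - m^-1 * lam], a strict kink, although [f] grows linearly
   and so penalizes large heights. *)
pose K := 2 + m^-1 * lam.
have mlam0 : 0 < m^-1 * lam by rewrite mulr_gt0 ?invr_gt0.
pose f (y : R) := y + K * expR (- y).
pose f1 (y : R) := 1 - K * expR (- y).
pose f2 (y : R) := K * expR (- y).
have dexp (t : R) : is_derive t 1 (fun y => expR (- y)) (- expR (- t)).
  have h := is_derive_scale (-1) (is_derive_var t).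
  have hN : is_derive t 1 (fun y : R => - y) (- 1).
    have <- : (fun y : R => -1 * y) = (fun y => - y) by apply/funext => z; rewrite mulN1r.
    by apply: is_derive_eq h _; rewrite mulr1.
  have h' := is_derive1_comp (is_derive_expR _) hN.
  by apply: is_derive_eq h' _; ring.
have df (t : R) : is_derive t 1 f (f1 t).
  have h := is_derive_add (is_derive_var t) (is_derive_scale K (dexp t)).
  by apply: is_derive_eq h _; rewrite /f1; ring.
have df1 (t : R) : is_derive t 1 f1 (f2 t).
  have h := is_derive_sub (is_derive_const 1 t) (is_derive_scale K (dexp t)).
  by apply: is_derive_eq h _; rewrite /f2; ring.
have f0 : f 0 = K by rewrite /f oppr0 expR0; ring.
have kink : f1 0 < - (m^-1 * lam) by rewrite /f1 oppr0 expR0 /K; lra.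
have K1 : 1 <= K by rewrite /K; lra.
have fge (t : R) : t <= f t by rewrite /f lerDl mulr_ge0 ?expR_ge0//; lra.
have bge0 x' y' : 0 <= barrier K f x' y'.
  by apply: barrier_ge0 => // y'0; exact: le_trans (fge _).
(* Bounds the penalty's contribution in [comparison], from [V' / V <= A^-1], [f1 <= 1] and
   [f2 <= K]. *)
pose C := 2 * delta + 2 / A + K.
have d2 : 0 < 2 * delta by rewrite mulr_gt0.
have A2 : 0 < 2 / A by rewrite divr_gt0.
have C0 : 0 < C by rewrite /C; lra.
have p1 : 0 < barrier K f x y + 1 by have := bge0 x y; lra.
(* The first entry keeps the penalized value at [(x, y)] above [1 + eta]; the second makes [eps * C]
   smaller than the cubic term. *)
pose eps := Num.min (eta / (barrier K f x y + 1)) (A ^+ 2 * eta / C).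
have A2eta : 0 < A ^+ 2 * eta by rewrite mulr_gt0// exprn_gt0.
have eps0 : 0 < eps by rewrite lt_min; apply/andP; split; exact: divr_gt0.
have epsp : eps * barrier K f x y <= eta.
  have : eps * (barrier K f x y + 1) <= eta by rewrite -ler_pdivlMr// /eps ge_min lexx.
  by rewrite mulrDr mulr1; lra.
have epsC : eps * C <= A ^+ 2 * eta.
  by rewrite -ler_pdivlMr// /eps ge_min lexx orbT.
have Fp : 1 + eta <= 1 * ratio x y - eps * barrier K f x y.
  by rewrite mul1r; move: epsp; rewrite /eta; lra.
have We0 : 0 <= W / eps by rewrite divr_ge0// ltW.
have ed0 : 0 < eps * delta by rewrite mulr_gt0.
(* [Q] is the value that [X ^+ 2] must reach on the lateral sides; since [X] is at least both 1 and
   [Q], so is its square. *)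
pose Q := (W + W * (W / eps) ^+ 2) / (eps * delta).
have WWe : 0 <= W * (W / eps) ^+ 2 by rewrite mulr_ge0// sqr_ge0.
have Q0 : 0 <= Q by rewrite divr_ge0 ?(ltW ed0)// addr_ge0.
pose X := `|x| + 1 + Q.
pose Y := `|y| + 1 + 2 * (W / eps) / kappa.
pose T := `|y| + 1 + W / eps.
have kWe : 0 <= 2 * (W / eps) / kappa by rewrite divr_ge0 ?(ltW kappa0)// mulr_ge0.
have x0 := normr_ge0 x; have y0 := normr_ge0 y.
have edX : W + W * (W / eps) ^+ 2 <= eps * (delta * X ^+ 2).
  have -> : W + W * (W / eps) ^+ 2 = eps * delta * Q.
    by rewrite /Q [RHS]mulrC divfK// gt_eqF.
  rewrite [leRHS]mulrA ler_pM2l//; have XQ : Q <= X by rewrite /X; lra.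
  have X1 : 1 <= X by rewrite /X; lra.
  by rewrite (le_trans XQ)// expr2 ler_peMl//; lra.
have [|||x1 [y1 [/andP[y1_gt0 _] Fle h]]] := comparison ha hm S
    (or_introl erefl) eps0 df df1 f0 kink (X := X) (Y := Y) (T := T) (x := x) (y := y).
- by rewrite /X; lra.
- by rewrite /Y /T; have := ler_norm y; have := ler_norm (- y); rewrite normrN; lra.
- move=> x' y' x'X y'Y bd; rewrite (lt_le_trans _ Fp)//.
  have [Wu Wl] := Wb x' y'; rewrite mul1r.
  have Y0 : 0 < Y by rewrite /Y; lra.
  have T0 : 0 < T by rewrite /T; lra.
  have YW : 2 * (W / eps) / kappa <= Y by rewrite /Y; lra.
  have TW : W / eps <= T by rewrite /T; lra.
  have := penalized_ratio_le0 W0 eps0 K1 fge Y0 T0 edX YW TW Wu Wl bd.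
  by move=> h; apply: (le_lt_trans h); lra.
have g1 : 1 + eta <= 1 * ratio x1 y1.
  have := mulr_ge0 (ltW eps0) (bge0 x1 y1); lra.
move: h; rewrite leNgt => /negP; apply.
rewrite mul1r in g1 *.
have [b0 b1] := andP (profile_log_derivative_bounds (ltW y1_gt0)).
have e1 : expR (- y1) <= 1 by rewrite expR_le1 oppr_le0 ltW.
have e0 := expR_gt0 (- y1).
have Lb : 2 * delta + 2 * (V' y1 / V y1) * f1 y1 + f2 y1 <= C.
  have Ke : 0 <= K * expR (- y1) <= K by rewrite mulr_ge0 ?ler_piMr ?(ltW e0)//; lra.
  have : V' y1 / V y1 * f1 y1 <= A^-1.
    by rewrite (le_trans _ b1)// ler_piMr// /f1; lra.
  by rewrite /C -[f2 y1]/(K * expR (- y1)) -mulrA; lra.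
rewrite (@le_lt_trans _ _ (eps * C))//; first by rewrite ler_pM2l.
rewrite (le_lt_trans epsC)//.
have vA := upper_profile_ge ha hm (ltW y1_gt0).
have vA2 : A ^+ 2 <= V y1 ^+ 2 by rewrite ler_sqr ?nnegrE ?(ltW A0)// (le_trans (ltW A0)).
apply: (@lt_le_trans _ _ (A ^+ 2 * (2 * eta))).
  by move: A2eta; rewrite [A ^+ 2 * (2 * eta)]mulrCA; move: (A ^+ 2 * eta) => z; lra.
apply: ler_pM => //; [by rewrite sqr_ge0|by rewrite mulr_ge0// ltW|].
by apply: cubic_ge => //; exact: ltW.
Qed.

End Bounds.

(** * Propagation of bounds downwards from a horizontal line *)

Section LowerBound.
Context {R : realType}.
Variables (a m : R) (u w : R * R -> R).
Hypotheses (ha : 0 < a) (hm : 0 < m) (S : regular_solution a m u w).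

Local Notation V := (upper_profile a m).
Local Notation V' := (upper_profile' a m).
Local Notation lam := (barrier_rate a m).
Local Notation delta := (barrier_weight a m).
Local Notation barrier := (barrier a m).
Local Notation ratio := (ratio a m w).

Lemma ratio_le1 x y : ratio x y <= 1.
Proof. by rewrite /ratio ler_pdivrMr ?U_gt0// mul1r (le_profile ha hm S). Qed.

(** A Phragmen-Lindelof principle on the half-plane [y <= T]: a bounded ratio whose cubic term has
    the favourable sign is controlled by its values on the top line. *)
Lemma boundary_bound (s T c G : R) : s = 1 \/ s = -1 -> 0 <= T ->
  (forall x y : R, 0 < y < T -> 0 <= s * ratio x y * ((s * ratio x y) ^+ 2 - 1)) ->
  (forall x : R, s * ratio x T <= c) -> (forall x y : R, s * ratio x y <= G) ->
  forall x y : R, y <= T -> s * ratio x y <= c.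
Proof.
move=> s1 T0 gsign bT bG x y yT; rewrite leNgt; apply/negP => cr.
have lam0 := barrier_rate_gt0 ha hm.
have delta0 := barrier_weight_gt0 ha hm.
have delta1 := barrier_weight_lt1 ha hm.
pose eta := (s * ratio x y - c) / 2.
have eta0 : 0 < eta by rewrite divr_gt0// subr_gt0.
have etaE : s * ratio x y = c + 2 * eta by rewrite /eta; lra.
have mlam0 : 0 < m^-1 * lam by rewrite mulr_gt0 ?invr_gt0.
have [b [b1 kinkb]] : exists b, 1 <= b /\ m^-1 * lam < b.
  by exists (m^-1 * lam + 1); lra.
(* On [[0, T]] this gives [f >= 1]. There [f] decreases, so the drift term helps, and [f'' = -2]
   outweighs [2 * delta], which makes the right-hand side of [comparison] negative. *)
pose K := 1 + b * T + T ^+ 2.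
pose f (y : R) := K - b * y - y ^+ 2.
pose f1 (y : R) := - b - 2 * y.
have df (t : R) : is_derive t 1 f (f1 t).
  have h := is_derive_sub (is_derive_sub (is_derive_const K t)
    (is_derive_scale b (is_derive_var t))) (is_derive_sqr t).
  by apply: is_derive_eq h _; rewrite /f1; ring.
have df1 (t : R) : is_derive t 1 f1 (- 2).
  have h := is_derive_sub (is_derive_const (- b) t) (is_derive_scale 2 (is_derive_var t)).
  by apply: is_derive_eq h _; ring.
have f0 : f 0 = K by rewrite /f; ring.
have kink : f1 0 < - (m^-1 * lam) by rewrite /f1; lra.
have bT0 : 0 <= b * T by rewrite mulr_ge0//; lra.
have TT0 : 0 <= T ^+ 2 by rewrite sqr_ge0.
have K1 : 1 <= K by rewrite /K; lra.
have bge0 x' y' : y' <= T -> 0 <= barrier K f x' y'.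
  move=> y'T; apply: (barrier_ge0 ha hm _ K1) => y'0; rewrite /f /K.
  have : b * y' <= b * T by rewrite ler_wpM2l//; lra.
  have : y' ^+ 2 <= T ^+ 2 by rewrite ler_sqr ?nnegrE.
  by lra.
have p1 : 0 < barrier K f x y + 1 by have := bge0 x y yT; lra.
have [eps eps0 epsp] : exists2 eps, 0 < eps & eps * barrier K f x y <= eta.
  exists (eta / (barrier K f x y + 1)); first by rewrite divr_gt0.
  by rewrite mulrAC ler_pdivrMr// ler_pM2l//; lra.
have Fp : c + eta <= s * ratio x y - eps * barrier K f x y by rewrite etaE; lra.
(* A nonnegative majorant of [G - c]: a penalty of size [D] on the lateral and bottom sides brings
   the bound [G] down to [c]. *)
pose D := `|G| + `|c|.
have D0 : 0 <= D by rewrite addr_ge0.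
have GcD : G - c <= D by rewrite lerD// ?ler_norm// -normrN ler_norm.
have [X xX XD] : exists2 X, `|x| <= X & D <= eps * (delta * X ^+ 2).
  have ed0 : 0 < eps * delta by rewrite mulr_gt0.
  have Q0 : 0 <= D / (eps * delta) by rewrite divr_ge0// ltW.
  have x0 := normr_ge0 x.
  exists (`|x| + 1 + D / (eps * delta)); first by lra.
  rewrite mulrA mulrC -ler_pdivrMr// expr2.
  move: (D / _) Q0 => Q Q0.
  have : 1 * Q <= (`|x| + 1 + Q) * (`|x| + 1 + Q) by apply: ler_pM => //; lra.
  by rewrite mul1r.
have [Y [Y0 yY YD]] : exists Y, [/\ 0 < Y, - Y <= y & D <= eps * (lam * Y)].
  have el0 : 0 < eps * lam by rewrite mulr_gt0.
  have Q0 : 0 <= D / (eps * lam) by rewrite divr_ge0// ltW.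
  have y0 := normr_ge0 y; have := ler_norm (- y); rewrite normrN => y1.
  exists (`|y| + 1 + D / (eps * lam)); split; [lra|lra|].
  by rewrite mulrA mulrC -ler_pdivrMr//; lra.
have [|x' y' x'X /andP[Yy' y'T] bd|x1 [y1 [y1T Fle h]]] := comparison ha hm S
    s1 eps0 df df1 f0 kink xX (Y := Y) (T := T) (y := y).
- by rewrite yY.
- rewrite (lt_le_trans _ Fp)//.
  suff : s * ratio x' y' - eps * barrier K f x' y' <= c by lra.
  have sG := bG x' y'; have b0 := mulr_ge0 (ltW eps0) (bge0 x' y' y'T).
  case: bd => [x'E|y'E|y'E]; last by have := bT x'; rewrite y'E in b0 *; lra.
  + have : eps * (delta * X ^+ 2) <= eps * barrier K f x' y'.
      rewrite ler_pM2l// -x'E real_normK ?num_real// /barrier lerDl.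
      have := bge0 0 y' y'T; rewrite /barrier expr0n /= mulr0 add0r//.
    lra.
  + have : eps * (lam * Y) <= eps * barrier K f x' y'.
      have y'0 : y' < 0 by rewrite y'E oppr_lt0.
      rewrite ler_pM2l// (le_trans _ (barrier_lower_ge _ _ _ _ K1 y'0))//.
      by rewrite y'E mulrN opprK lerDr mulr_ge0 ?sqr_ge0// ltW.
    lra.
move: h; rewrite leNgt => /negP; apply.
have y1_gt0 : 0 < y1 by case/andP: y1T.
apply: (@lt_le_trans _ _ 0); last by rewrite mulr_ge0 ?sqr_ge0 ?gsign.
rewrite pmulr_rlt0// /f1.
have [r0 _] := andP (profile_log_derivative_bounds ha hm (ltW y1_gt0)).
have : 0 <= V' y1 / V y1 * (b + 2 * y1) by rewrite mulr_ge0//; lra.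
by move: (V' y1 / V y1) => r; lra.
Qed.

(* The line x_2 = 0 is the top boundary here. *)
Lemma lower_zero : (forall x, w (x, 0) = 0) -> forall x y, y <= 0 -> w (x, y) = 0.
Proof.
move=> w0 x y y0; apply/eqP; rewrite eq_le (rs_ge0 S) andbT (@ratioE _ a m w ha hm).
rewrite pmulr_lle0 ?U_gt0// -[leLHS]mul1r.
apply: (@boundary_bound 1 0 0 1) => //; first by left.
- by move=> ? z; lra.
- by move=> z; rewrite /ratio w0 mul0r mulr0.
- by move=> *; rewrite mul1r ratio_le1.
Qed.

(** Because [U < 1], a nonnegative lower bound for [w] on the line is also one for the ratio, and
    the previous principle applies to [- ratio]: its cubic term is [q (1 - q^2)] with
    [0 <= q <= 1]. *)
Lemma ratio_ge (c T : R) : 0 <= T -> (forall x, c <= w (x, T)) -> 0 <= c ->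
  forall x y, y <= T -> c <= ratio x y.
Proof.
move=> T0 cT c0 x y yT; rewrite -lerN2 -mulN1r.
apply: (@boundary_bound (-1) T (- c) 0) => //; first by right.
- move=> x' y' _; rewrite mulN1r sqrrN mulNr -mulrN opprB.
  rewrite mulr_ge0 ?(ratio_ge0 ha hm S)// subr_ge0 expr_le1 ?(ratio_ge0 ha hm S)//.
  exact: ratio_le1.
- move=> z; rewrite mulN1r lerN2 /ratio ler_pdivlMr ?U_gt0//.
  by rewrite (le_trans _ (cT z))// ler_piMr// ltW ?U_lt1.
- by move=> *; rewrite mulN1r oppr_le0 (ratio_ge0 ha hm S).
Qed.

End LowerBound.

(** * Estimates above the interface *)

Section InteriorEstimates.
Context {R : realType}.
Variables (a m : R) (u w : R * R -> R).
Hypotheses (ha : 0 < a) (hm : 0 < m) (S : regular_solution a m u w).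

Lemma laplacian_upper x y : 0 < y ->
  'D_e1 ('D_e1 u) (x, y) + 'D_e2 ('D_e2 u) (x, y) = - ((1 - w (x, y) ^+ 2) * w (x, y)).
Proof.
move=> y0; have [/(_ (x, y) y0) lap _ _ _] := rs_solution S.
by rewrite (rs_eq S) ?gt_eqF// -lap opprK.
Qed.

(** The upper bound [w <= U < 1] gives the reaction term its sign. *)
Lemma superharmonic x y : 0 < y ->
  'D_e1 ('D_e1 u) (x, y) + 'D_e2 ('D_e2 u) (x, y) <= 0.
Proof.
move=> y0; rewrite laplacian_upper// oppr_le0 mulr_ge0 ?(rs_ge0 S)// subr_ge0.
rewrite expr_le1 ?(rs_ge0 S)// (le_trans (le_profile ha hm S _ _))//.
exact/ltW/U_lt1.
Qed.

(* [y / sqr_dist x0 y0 x y] is, up to a constant, [`|f|^-2 - 1] for the Moebius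
   map [f] sending the upper half-plane to the disc and [(x0, y0)] to [0]: it
   vanishes on the boundary and at infinity, and its Laplacian
   [4 * y0 / sqr_dist ^ 2] is positive. *)
Lemma touch_pole (x0 y0 x y c M r : R) : 0 < y0 -> 0 < y -> 0 < c -> 0 < r ->
  (forall x' y', `|x' - x| < r -> `|y' - y| < r ->
    [/\ 0 < y', 0 < sqr_dist x0 y0 x' y' &
        c * (y' / sqr_dist x0 y0 x' y') - w (x', y') <= M]) ->
  c * (y / sqr_dist x0 y0 x y) - w (x, y) = M -> False.
Proof.
move=> y0_gt0 y_gt0 c0 r0 wle weq.
have xx : `|x - x| < r by rewrite subrr normr0.
have yy : `|y - y| < r by rewrite subrr normr0.
have [_ rho0 _] := wle _ _ xx yy.
have rhoN0 : sqr_dist x0 y0 x y != 0 by rewrite gt_eqF.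
have wE x' y' : `|y' - y| < r -> w (x', y') = u (x', y').
  by move=> yr; apply: (rs_eq S); rewrite gt_eqF//; have [] := wle _ _ xx yr.
have h1 : -1 * 'D_e1 ('D_e1 u) (x, y) <=
    - c * y * (8 * (x - x0) ^+ 2 * (sqr_dist x0 y0 x y)^-1 ^+ 3 -
               2 * (sqr_dist x0 y0 x y)^-1 ^+ 2).
  refine (@touch_e1 _ u x y (-1) r (fun x => M - c * (y * (sqr_dist x0 y0 x y)^-1))
    (fun x => c * y * (2 * ((x - x0) * ((sqr_dist x0 y0 x y)^-1 * (sqr_dist x0 y0 x y)^-1))))
    _ r0 _ _ _ _ _ _).
  - by move=> x' _; apply: (rs_derivable1 S); rewrite gt_eqF.
  - by apply: (rs_derivable11 S); rewrite gt_eqF.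
  - move=> x' x'r; have [_ rho' _] := wle _ _ x'r yy.
    have h := is_derive_inv (is_derive_sqr_dist1 x0 y0 x' y) (lt0r_neq0 rho').
    have h' := is_derive_sub (is_derive_const M x') (is_derive_scale c (is_derive_scale y h)).
    by apply: is_derive_eq h' _; ring.
  - have h := is_derive_inv (is_derive_sqr_dist1 x0 y0 x y) rhoN0.
    have hx := is_derive_sub (is_derive_var x) (is_derive_const x0 x).
    have h' := is_derive_scale (c * y) (is_derive_scale 2 (is_derive_mul hx (is_derive_mul h h))).
    by apply: is_derive_eq h' _; ring.
  - by move=> x' x'r; have [_ _] := wle _ _ x'r yy; rewrite -wE//; lra.
  - by rewrite -wE// -weq; ring.
have h2 : -1 * 'D_e2 ('D_e2 u) (x, y) <=
    - c * (8 * y * (y - y0) ^+ 2 * (sqr_dist x0 y0 x y)^-1 ^+ 3 -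
           2 * (y + 2 * (y - y0)) * (sqr_dist x0 y0 x y)^-1 ^+ 2).
  refine (@touch_e2 _ u x y (-1) r (fun y => M - c * (y * (sqr_dist x0 y0 x y)^-1))
    (fun y => c * (2 * (y * ((y - y0) *
        ((sqr_dist x0 y0 x y)^-1 * (sqr_dist x0 y0 x y)^-1))) - (sqr_dist x0 y0 x y)^-1))
    _ r0 _ _ _ _ _ _).
  - move=> y' y'r; apply: (rs_derivable2 S); rewrite gt_eqF//.
    by have [] := wle _ _ xx y'r.
  - by apply: (rs_derivable22 S); rewrite gt_eqF.
  - move=> y' y'r; have [_ rho' _] := wle _ _ xx y'r.
    have h := is_derive_inv (is_derive_sqr_dist2 x0 y0 x y') (lt0r_neq0 rho').
    have h' := is_derive_sub (is_derive_const M y')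
      (is_derive_scale c (is_derive_mul (is_derive_var y') h)).
    by apply: is_derive_eq h' _; ring.
  - have h := is_derive_inv (is_derive_sqr_dist2 x0 y0 x y) rhoN0.
    have hy := is_derive_sub (is_derive_var y) (is_derive_const y0 y).
    have h' := is_derive_scale c (is_derive_sub (is_derive_scale 2
      (is_derive_mul (is_derive_var y) (is_derive_mul hy (is_derive_mul h h)))) h).
    by apply: is_derive_eq h' _; ring.
  - by move=> y' y'r; have [_ _] := wle _ _ xx y'r; rewrite -wE//; lra.
  - by rewrite -wE// -weq; ring.
have := lerD h1 h2; rewrite -mulrDr mulN1r.
have : 0 <= - ('D_e1 ('D_e1 u) (x, y) + 'D_e2 ('D_e2 u) (x, y)).
  by rewrite oppr_ge0 superharmonic.
move=> /le_trans /[apply].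
have -> : - c * y * (8 * (x - x0) ^+ 2 * (sqr_dist x0 y0 x y)^-1 ^+ 3 -
               2 * (sqr_dist x0 y0 x y)^-1 ^+ 2) +
    - c * (8 * y * (y - y0) ^+ 2 * (sqr_dist x0 y0 x y)^-1 ^+ 3 -
           2 * (y + 2 * (y - y0)) * (sqr_dist x0 y0 x y)^-1 ^+ 2) =
    - (4 * c * y0 * (sqr_dist x0 y0 x y)^-1 ^+ 2).
  by rewrite /sqr_dist in rhoN0 *; field.
by rewrite oppr_ge0 leNgt mulr_gt0 ?exprn_gt0 ?invr_gt0// !mulr_gt0.
Qed.

(** Strong maximum principle by one global subsolution [c * y / rho], which lies below [w] near its
    pole [(x0, y0)], vanishes on the interface and at infinity, and is positive at every point above
    the interface. A zero of [w] would give its excess over [w] a positive interior maximum, which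
    [touch_pole] excludes. *)
Lemma upper_positive x0 y0 : 0 < y0 -> 0 < w (x0, y0) ->
  forall x y, 0 < y -> 0 < w (x, y).
Proof.
move=> y0_gt0 w0 x y y_gt0; rewrite lt_neqAle (rs_ge0 S) andbT.
apply/eqP => /esym wxy.
have cw := rs_continuous S.
pose h := w (x0, y0) / 2; have h0 : 0 < h by rewrite divr_gt0.
have [e e0 we] : exists2 e, 0 < e &
    forall x' y', `|x' - x0| < e -> `|y' - y0| < e -> h < w (x', y').
  by apply: near_gt; [exact: cw|rewrite /h; lra].
pose r := e / 2; have r0 : 0 < r by rewrite divr_gt0.
have rr0 : 0 < r ^+ 2 by rewrite exprn_gt0.
pose rho := sqr_dist x0 y0.
have close x' y' : rho x' y' <= r ^+ 2 -> `|x' - x0| <= r /\ `|y' - y0| <= r.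
  move=> rle; have sx := sqr_ge0 (x' - x0); have sy := sqr_ge0 (y' - y0).
  by split; rewrite -ler_sqr ?nnegrE ?(ltW r0)// real_normK ?num_real//;
    move: rle; rewrite /rho /sqr_dist; lra.
have wclose x' y' : rho x' y' <= r ^+ 2 -> h < w (x', y').
  have re : r < e by rewrite /r; lra.
  by move=> /close[x'r y'r]; apply: we; exact: le_lt_trans re.
have yr0 : 0 < y0 + r by rewrite addr_gt0.
(* On the disc of radius [r] the height is at most [y0 + r], so [c * y / r ^+ 2 <= h < w] there. *)
pose c := h * r ^+ 2 / (y0 + r); have c0 : 0 < c by rewrite divr_gt0 ?mulr_gt0.
(* Truncating [rho] removes the pole and keeps [F] continuous; the truncated disc, where [F < 0],
   cannot contain the maximum. *)
pose F (p : R * R) := c * p.2 / Num.max (rho p.1 p.2) (r ^+ 2) - w p.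
have mx0 x' y' : 0 < Num.max (rho x' y') (r ^+ 2) by rewrite lt_max rr0 orbT.
have Fclose x' y' : rho x' y' <= r ^+ 2 -> F (x', y') < 0.
  move=> rle; have wh := wclose _ _ rle; have [_ yr] := close _ _ rle.
  rewrite /F /= (max_idPr _)// subr_lt0 (le_lt_trans _ wh)//.
  rewrite ler_pdivrMr// /c mulrAC ler_pdivrMr// ler_pM2l ?mulr_gt0//.
  by move: yr; rewrite ler_norml; lra.
have cF : continuous F.
  move=> p; apply: cvgB; last exact: cw.
  apply: cvgM; first by apply: cvgM; [exact: cvg_cst|exact: cvg_snd].
  apply: cvgV; first by rewrite gt_eqF.
  have := @continuous_max R (R * R)%type (fun p => rho p.1 p.2) (cst (r ^+ 2)) p.
  by apply; [exact: sqr_dist_continuous|exact: cvg_cst].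
have rho_xy : r ^+ 2 < rho x y.
  by rewrite ltNge; apply/negP => /wclose; rewrite wxy; lra.
pose v := F (x, y).
have v0 : 0 < v.
  by rewrite /v /F /= wxy subr0; apply: divr_gt0; [exact: mulr_gt0|exact: mx0].
have c16 : 0 < 16 * c by rewrite pmulr_rgt0.
(* On the top side [rho >= (T / 2) ^+ 2] because [T >= 2 * y0], and [16 * c < v * T] then gives
   [c * T < v * rho]; [X] gives the same inequality on the lateral sides. *)
pose T := 2 * y0 + y + 16 * c / v.
have cv0 : 0 < 16 * c / v by exact: divr_gt0.
have T0 : 0 < T by rewrite /T; lra.
pose X := `|x - x0| + 1 + c * T / v.
have cTv0 : 0 < c * T / v by apply: divr_gt0 => //; exact: mulr_gt0.
have xn0 := normr_ge0 (x - x0).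
have small x' y' : 0 <= y' <= T -> c * T < v * rho x' y' -> F (x', y') < v.
  move=> y'T crho; rewrite /F /= ltrBlDr ltr_wpDr ?(rs_ge0 S)//.
  rewrite ltr_pdivrMr// (@le_lt_trans _ _ (c * T))//.
    by rewrite ler_pM2l//; case/andP: y'T.
  by rewrite (lt_le_trans crho)// ler_pM2l// le_max lexx.
have [|||x' y' x'X y'T bd|x2 [y2 [_ /andP[y2_gt0 y2T] Fle [d d0 dmax]]]] :=
  @rectangle_max _ F (x0 - X) (x0 + X) 0 T x y.
- by move=> *; exact: cF.
- have := ler_norm (x - x0); have := ler_norm (- (x - x0)); rewrite normrN /X; lra.
- by rewrite /T; lra.
- have XX : c * T < v * X ^+ 2.
    have X1 : 1 <= X by rewrite /X; lra.
    rewrite [ltRHS]mulrC -ltr_pdivrMr// (@lt_le_trans _ _ X)//; first by rewrite /X; lra.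
    by rewrite expr2 ler_peMl//; lra.
  have sy := sqr_ge0 (y' - y0); have sx := sqr_ge0 (x' - x0).
  have vsy := mulr_ge0 (ltW v0) sy; have vsx := mulr_ge0 (ltW v0) sx.
  case: bd => [x'E|x'E|y'E|y'E].
  + by apply: small => //; move: vsy XX; rewrite /rho /sqr_dist x'E; lra.
  + by apply: small => //; move: vsy XX; rewrite /rho /sqr_dist x'E; lra.
  + rewrite y'E -/v (le_lt_trans _ v0)// /F /= mulr0 mul0r sub0r oppr_le0.
    exact: (rs_ge0 S).
  + apply: small => //; rewrite /rho /sqr_dist [ltRHS]mulrDr ltr_wpDl// y'E.
    have T2 : 0 < T / 2 <= T - y0 by rewrite /T; lra.
    apply: (@lt_le_trans _ _ (v * (T / 2) ^+ 2)); last first.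
      by rewrite ler_pM2l// ler_sqr ?nnegrE; lra.
    have : 16 * c < v * T.
      by rewrite [ltRHS]mulrC -ltr_pdivrMr// /T; lra.
    have -> : v * (T / 2) ^+ 2 = v * T / 4 * T by field.
    by move=> vT; rewrite ltr_pM2r//; lra.
have rho2 : r ^+ 2 < rho x2 y2.
  rewrite ltNge; apply/negP => /Fclose F0.
  by have := lt_le_trans v0 Fle; rewrite ltNge ltW.
have [d' d'0 rhod'] := near_gt (@sqr_dist_continuous R x0 y0 (x2, y2)) rho2.
pose q := Num.min (Num.min d d') y2.
have q0 : 0 < q by rewrite !lt_min d0 d'0.
have FE x' y' : r ^+ 2 < rho x' y' ->
    F (x', y') = c * (y' / rho x' y') - w (x', y').
  by move=> rr; rewrite /F /= (max_idPl (ltW rr)) mulrA.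
apply: (@touch_pole x0 y0 x2 y2 c (F (x2, y2)) q) => //; last by rewrite FE.
move=> x' y'; rewrite !lt_min => /andP[/andP[xd xd'] _] /andP[/andP[yd yd'] yq].
have rr := rhod' _ _ xd' yd'.
split; first by move: yq; rewrite ltr_norml; lra.
  exact: lt_trans rr.
by rewrite -FE//; have [] := dmax _ _ xd yd.
Qed.

(* The bump [(r ^ 2 - rho) ^ 2] satisfies [- Lap <= 8 / r ^ 2 * bump] on the disc
   of radius [r]; comparing it with [w] at a maximum point of [bump / w] gives a
   bound there which is transported to the center. *)
Lemma disc_bound (r x0 y0 : R) : 0 < r < y0 -> (forall x y, 0 < y -> 0 < w (x, y)) ->
  1 - 8 / r ^+ 2 <= w (x0, y0) ^+ 2.
Proof.
move=> /andP[r0 ry0] wpos.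
have rr0 : 0 < r ^+ 2 by rewrite exprn_gt0.
pose rho := sqr_dist x0 y0.
(* Clipping at 0 lets the maximum be sought on the square circumscribed about the disc, on whose
   boundary [bump] vanishes. *)
pose bump (p : R * R) := Num.max (r ^+ 2 - rho p.1 p.2) 0.
pose F (p : R * R) := bump p * bump p / w p.
have rhoc : rho x0 y0 = 0 by rewrite /rho /sqr_dist !subrr expr0n addr0.
have Fc : F (x0, y0) = r ^+ 2 * r ^+ 2 / w (x0, y0).
  by rewrite /F /bump /= rhoc subr0 (max_idPl (ltW rr0)).
have y0_gt0 : 0 < y0 by apply: lt_trans ry0.
have wc := wpos x0 y0 y0_gt0.
have Fc0 : 0 < F (x0, y0) by rewrite Fc divr_gt0 ?mulr_gt0.
have crho : continuous (fun p : R * R => r ^+ 2 - rho p.1 p.2).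
  by move=> p; apply: cvgB; [exact: cvg_cst|exact: sqr_dist_continuous].
have cbump : continuous bump.
  move=> p; have := @continuous_max R (R * R)%type (fun p => r ^+ 2 - rho p.1 p.2) (cst 0) p.
  by apply; [exact: crho|exact: cvg_cst].
have [|||x' y' x'r y'r bd|x [y [_ yr Fle [d d0 dmax]]]] :=
  @rectangle_max _ F (x0 - r) (x0 + r) (y0 - r) (y0 + r) x0 y0.
- move=> x' y' _ y'r; apply: cvgM; first by apply: cvgM; exact: cbump.
  apply: cvgV; last exact: (rs_continuous S).
  by rewrite gt_eqF// wpos//; lra.
- lra.
- lra.
- suff rho_ge : r ^+ 2 <= rho x' y'.
    by rewrite {1}/F /bump /= (max_idPr _) ?subr_le0// mul0r mul0r.
  rewrite /rho /sqr_dist; have sy := sqr_ge0 (y' - y0); have sx := sqr_ge0 (x' - x0).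
  have e1 : (r ^+ 2 = (- r) ^+ 2) by rewrite sqrrN.
  case: bd => ->.
  + by rewrite [x0 - r - x0](_ : _ = - r) -?e1 ?lerDl//; ring.
  + by rewrite [x0 + r - x0](_ : _ = r) ?lerDl//; ring.
  + by rewrite [y0 - r - y0](_ : _ = - r) -?e1 ?lerDr//; ring.
  + by rewrite [y0 + r - y0](_ : _ = r) ?lerDr//; ring.
pose M := F (x, y).
have M0 : 0 < M by exact: lt_le_trans Fle.
have y_gt0 : 0 < y by lra.
have rho_lt : 0 < r ^+ 2 - rho x y.
  rewrite ltNge; apply/negP => le0; move: M0.
  by rewrite /M /F /bump /= (max_idPr le0) mul0r mul0r ltxx.
have [d' d'0 rhod'] := near_gt (crho (x, y)) rho_lt.
have FE x' y' : 0 < r ^+ 2 - rho x' y' ->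
    F (x', y') = (r ^+ 2 - rho x' y') ^+ 2 / w (x', y').
  by move=> rr; rewrite /F /bump /= (max_idPl (ltW rr)) expr2.
pose q := Num.min (Num.min d d') y.
have q0 : 0 < q by rewrite !lt_min d0 d'0.
have near_q x' y' : `|x' - x| < q -> `|y' - y| < q -> 0 < y' /\
    -1 * w (x', y') <= - M^-1 * ((r ^+ 2 - rho x' y') * (r ^+ 2 - rho x' y')).
  rewrite !lt_min => /andP[/andP[xd xd'] _] /andP[/andP[yd yd'] yq].
  have y'0 : 0 < y' by move: yq; rewrite ltr_norml; lra.
  split=> //; have [_ _] := dmax _ _ xd yd; rewrite FE ?rhod'// -/M.
  rewrite ler_pdivrMr ?wpos// => h; rewrite mulN1r mulNr lerN2 -expr2.
  by rewrite mulrC ler_pdivrMr// mulrC.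
have xx : `|x - x| < q by rewrite subrr normr0.
have yy : `|y - y| < q by rewrite subrr normr0.
have weq : -1 * w (x, y) = - M^-1 * ((r ^+ 2 - rho x y) * (r ^+ 2 - rho x y)).
  have w0 := wpos x y y_gt0.
  by rewrite /M FE// -expr2; field; rewrite !gt_eqF.
have wE x' y' : 0 < y' -> w (x', y') = u (x', y').
  by move=> y'0; apply: (rs_eq S); rewrite gt_eqF.
have h1 : -1 * 'D_e1 ('D_e1 u) (x, y) <=
    4 * M^-1 * ((r ^+ 2 - rho x y) - 2 * (x - x0) ^+ 2).
  refine (@touch_e1 _ u x y (-1) q
    (fun x => - M^-1 * ((r ^+ 2 - rho x y) * (r ^+ 2 - rho x y)))
    (fun x => 4 * M^-1 * ((r ^+ 2 - rho x y) * (x - x0))) _ q0 _ _ _ _ _ _).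
  - by move=> x' _; apply: (rs_derivable1 S); rewrite gt_eqF.
  - by apply: (rs_derivable11 S); rewrite gt_eqF.
  - move=> x' _.
    have h := is_derive_sub (is_derive_const (r ^+ 2) x') (is_derive_sqr_dist1 x0 y0 x' y).
    have h' := is_derive_scale (- M^-1) (is_derive_mul h h).
    by apply: is_derive_eq h' _; rewrite -/(rho _ _); ring.
  - have h := is_derive_sub (is_derive_const (r ^+ 2) x) (is_derive_sqr_dist1 x0 y0 x y).
    have hx := is_derive_sub (is_derive_var x) (is_derive_const x0 x).
    have h' := is_derive_scale (4 * M^-1) (is_derive_mul h hx).
    by apply: is_derive_eq h' _; rewrite -/(rho _ _); ring.
  - by move=> x' x'q; have [_] := near_q _ _ x'q yy; rewrite wE.
  - by rewrite -wE.
have h2 : -1 * 'D_e2 ('D_e2 u) (x, y) <=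
    4 * M^-1 * ((r ^+ 2 - rho x y) - 2 * (y - y0) ^+ 2).
  refine (@touch_e2 _ u x y (-1) q
    (fun y => - M^-1 * ((r ^+ 2 - rho x y) * (r ^+ 2 - rho x y)))
    (fun y => 4 * M^-1 * ((r ^+ 2 - rho x y) * (y - y0))) _ q0 _ _ _ _ _ _).
  - move=> y' y'q; apply: (rs_derivable2 S); rewrite gt_eqF//.
    by have [] := near_q _ _ xx y'q.
  - by apply: (rs_derivable22 S); rewrite gt_eqF.
  - move=> y' _.
    have h := is_derive_sub (is_derive_const (r ^+ 2) y') (is_derive_sqr_dist2 x0 y0 x y').
    have h' := is_derive_scale (- M^-1) (is_derive_mul h h).
    by apply: is_derive_eq h' _; rewrite -/(rho _ _); ring.
  - have h := is_derive_sub (is_derive_const (r ^+ 2) y) (is_derive_sqr_dist2 x0 y0 x y).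
    have hy := is_derive_sub (is_derive_var y) (is_derive_const y0 y).
    have h' := is_derive_scale (4 * M^-1) (is_derive_mul h hy).
    by apply: is_derive_eq h' _; rewrite -/(rho _ _); ring.
  - by move=> y' y'q; have [y'0] := near_q _ _ xx y'q; rewrite wE.
  - by rewrite -wE.
have := lerD h1 h2; rewrite -mulrDr laplacian_upper// mulN1r opprK -mulrDr.
pose t := r ^+ 2 - rho x y.
have -> : r ^+ 2 - rho x y - 2 * (x - x0) ^+ 2 + (r ^+ 2 - rho x y - 2 * (y - y0) ^+ 2) =
    2 * (2 * t - r ^+ 2).
  by rewrite /t /rho /sqr_dist; ring.
move=> wbound; have w0 := wpos x y y_gt0.
have wt : M^-1 * t ^+ 2 = w (x, y) by apply: oppr_inj; rewrite -mulNr expr2 -[RHS]mulN1r weq.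
(* Here [- Lap (t ^+ 2) = 8 * (2 * t - r ^+ 2)], which is the origin of the constant 8; the
   inequality is [(t - r ^+ 2) ^+ 2 >= 0]. *)
have tr : 2 * t - r ^+ 2 <= t ^+ 2 / r ^+ 2.
  rewrite ler_pdivlMr// -subr_ge0.
  have -> : t ^+ 2 - (2 * t - r ^+ 2) * r ^+ 2 = (t - r ^+ 2) ^+ 2 by ring.
  exact: sqr_ge0.
have : (1 - w (x, y) ^+ 2) * w (x, y) <= 8 / r ^+ 2 * w (x, y).
  rewrite (le_trans wbound)// -wt.
  have -> : 8 / r ^+ 2 * (M^-1 * t ^+ 2) = 4 * M^-1 * (2 * (t ^+ 2 / r ^+ 2)) by ring.
  by rewrite ler_pM2l ?mulr_gt0 ?invr_gt0// ler_pM2l.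
rewrite ler_pM2r// => w2.
(* Comparing [M] with the value of [F] at the center gives [r ^ 4 / M <= w (x0, y0)], while
   [w (x, y) = t ^+ 2 / M] and [t <= r ^+ 2]. *)
have wxc : w (x, y) <= w (x0, y0).
  have Mle : r ^+ 2 * r ^+ 2 / w (x0, y0) <= M by rewrite -Fc.
  have rho0 : 0 <= rho x y by rewrite addr_ge0 ?sqr_ge0.
  rewrite -wt mulrC ler_pdivrMr//; move: Mle; rewrite ler_pdivrMr// [leRHS]mulrC => Mle.
  by rewrite (le_trans _ Mle)// expr2 ler_pM ?(ltW rho_lt)// gerBl.
have wsq : w (x, y) ^+ 2 <= w (x0, y0) ^+ 2 by rewrite ler_sqr ?nnegrE ?(rs_ge0 S).
by rewrite lerBlDl (le_trans _ (lerD (lexx _) wsq))// -lerBlDr.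
Qed.

Lemma unique_positive x0 y0 : 0 < y0 -> 0 < w (x0, y0) -> forall x y, w (x, y) = U a m y.
Proof.
move=> y0_gt0 w0 x y; have wpos := upper_positive y0_gt0 w0.
apply/eqP; rewrite eq_le (le_profile ha hm S) /= leNgt; apply/negP => wU.
have Up := U_gt0 ha hm y.
have q1 : ratio a m w x y < 1 by rewrite /ratio ltr_pdivrMr// mul1r.
pose q := 1 - ratio a m w x y; have q0 : 0 < q by rewrite subr_gt0.
have qle1 : q <= 1 by have := ratio_ge0 ha hm S x y; rewrite /q; lra.
(* [16 / q] together with [r <= r ^+ 2] forces [8 / r ^+ 2 < q], and [|y|] places the point below
   the line at height [r + 1]. On that line [disc_bound] bounds [w ^+ 2], hence also [w], since
   [0 <= w <= 1]. *)
pose r := `|y| + 4 + 16 / q.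
have q16 : 0 < 16 / q by rewrite divr_gt0.
have r4 : 4 <= r by have := normr_ge0 y; rewrite /r; lra.
have r2 : 8 / r ^+ 2 < q.
  have rr : r <= r ^+ 2 by rewrite expr2 ler_peMl//; lra.
  rewrite ltr_pdivrMr; last lra.
  have : q * r <= q * r ^+ 2 by rewrite ler_pM2l.
  have : q * (16 / q) <= q * r by rewrite ler_pM2l// /r; have := normr_ge0 y; lra.
  by rewrite mulrC divfK ?gt_eqF//; lra.
have : 1 - 8 / r ^+ 2 <= ratio a m w x y.
  apply: (@ratio_ge _ a m u w ha hm S _ (r + 1)); [lra| |lra|].
    move=> z; have zr : 0 < r < r + 1 by lra.
    rewrite (le_trans (disc_bound z zr wpos))// expr2 ler_piMl ?(rs_ge0 S)//.
    by rewrite (le_trans (le_profile ha hm S _ _))// ltW ?U_lt1.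
  by have := ler_norm y; rewrite /r; lra.
by move: r2; rewrite /q; lra.
Qed.

(** The nonzero value may lie on or below the interface. If [w] vanished everywhere above, it would
    vanish on the interface by continuity and below it by [lower_zero]. *)
Lemma unique_nonzero x0 y0 : w (x0, y0) != 0 -> forall x y, w (x, y) = U a m y.
Proof.
move=> w0; have [[p [p0 wp]]|none] := pselect (exists p : R * R, 0 < p.2 /\ 0 < w p).
  by case: p p0 wp => x1 y1; exact: unique_positive.
have wu x y : 0 < y -> w (x, y) = 0.
  move=> y0'; apply/eqP; rewrite eq_le (rs_ge0 S) andbT leNgt; apply/negP => wxy.
  by apply: none; exists (x, y).
have wb x : w (x, 0) = 0.
  apply/eqP; rewrite eq_le (rs_ge0 S) andbT leNgt; apply/negP => wx.
  have [e e0 we] := near_gt (rs_continuous S (x := (x, 0))) wx.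
  have : 0 < w (x, e / 2).
    by apply: we; rewrite ?subrr ?normr0 ?subr0 ?gtr0_norm ?divr_gt0//; lra.
  by rewrite wu ?divr_gt0// ltxx.
move: w0; have [y0_gt0|y0_le0] := ltP 0 y0; first by rewrite wu ?eqxx.
by rewrite (lower_zero ha hm S wb)// eqxx.
Qed.

End InteriorEstimates.

(** * Measure-theoretic facts and the continuous representative *)

Section LebesgueMeasure.
Context {R : realType}.
Local Notation mu := (@lebesgue2 R).

Lemma lebesgue2_line : mu.-negligible [set p : R * R | p.2 = 0].
Proof.
exists (setT `*` [set 0]); split.
- by apply: measurableX => //; exact: measurable_set1.
- rewrite [LHS]product_measure1E; [|exact: measurableT|exact: measurable_set1].
  by rewrite [X in (_ * X)%E]lebesgue_measure_set1 mule0.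
- by move=> p /= p0; split.
Qed.

Lemma lebesgue2_square (x y e : R) : 0 < e -> (0 < mu (ball x e `*` ball y e))%E.
Proof.
move=> e0; rewrite /lebesgue2 product_measure1E; [|exact: measurable_ball|exact: measurable_ball].
have he := lebesgue_measure_ball x (ltW e0); have he' := lebesgue_measure_ball y (ltW e0).
by rewrite [X in (X * _)%E]he [X in (_ * X)%E]he' -EFinM lte_fin mulr_gt0 ?pmulrn_lgt0.
Qed.

(** The norm of exponent [+oo] is an essential supremum only on a space of positive measure, so
    unfolding it requires this. *)
Lemma lebesgue2_setT : (0 < mu setT)%E.
Proof.
apply: (lt_le_trans (lebesgue2_square 0 0 ltr01)).
by apply: le_measure; rewrite ?inE//; apply: measurableX; exact: measurable_ball.
Qed.

Lemma negligible_near (N : set (R * R)) (p : R * R) (e : R) : mu.-negligible N -> 0 < e ->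
  exists2 q, ball p e q & ~ N q.
Proof.
move=> [B [mB B0 NB]] e0; apply: contrapT => nq.
have sub : ball p.1 e `*` ball p.2 e `<=` B.
  move=> q qe; apply: NB; apply: contrapT => nN; apply: nq.
  by exists q => //; case: qe.
have := lebesgue2_square p.1 p.2 e0; rewrite ltNge => /negP; apply.
rewrite -[leRHS]B0; apply: le_measure; rewrite ?inE//.
by apply: measurableX; exact: measurable_ball.
Qed.

Lemma Linfty_bounded (u : R * R -> R) : u \in Lfun mu +oo%E ->
  exists M, {ae mu, forall p, u p <= M}.
Proof.
move=> /andP[_]; rewrite inE /= /finite_norm unlock lebesgue2_setT => fin.
apply: ess_supr_bounded; apply: le_lt_trans fin.
apply: le_ess_sup; apply: aeW => p /=; rewrite lee_fin; exact: ler_norm.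
Qed.

Lemma bounded_Linfty (u : R * R -> R) (M : R) : measurable_fun setT u ->
  (forall p, `|u p| <= M) -> u \in Lfun mu +oo%E.
Proof.
move=> mu_ uM; apply/andP; split; rewrite inE//=.
rewrite /finite_norm unlock lebesgue2_setT.
apply: (@le_lt_trans _ _ M%:E); last exact: ltry.
by apply/ess_supP; apply: aeW => p /=; rewrite lee_fin.
Qed.

End LebesgueMeasure.

(** * The continuous representative of a solution *)

Section Representative.
Context {R : realType}.
Implicit Types (u g : R * R -> R).

Lemma closure_upper (x y : R) : 0 <= y -> closure upper_half (x, y).
Proof.
move=> y0 B /(@nbhs_ballP R (R * R)%type) [e /= e0 eB]; exists (x, y + e / 2).
have e2 : 0 < e / 2 by rewrite divr_gt0.
split; first by rewrite /upper_half /=; lra.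
apply: eB; split; rewrite /ball /=; first by rewrite subrr normr0.
by rewrite opprD addNKr normrN gtr0_norm//; lra.
Qed.

Lemma closure_lower (x y : R) : y <= 0 -> closure lower_half (x, y).
Proof.
move=> y0 B /(@nbhs_ballP R (R * R)%type) [e /= e0 eB]; exists (x, y - e / 2).
have e2 : 0 < e / 2 by rewrite divr_gt0.
split; first by rewrite /lower_half /=; lra.
apply: eB; split; rewrite /ball /=; first by rewrite subrr normr0.
by rewrite opprB addrC subrK gtr0_norm//; lra.
Qed.

Lemma within_continuous_comp g (A : set (R * R)) (f : R * R -> R * R) :
  {within A, continuous g} -> continuous f -> (forall p, A (f p)) -> continuous (g \o f).
Proof.
move=> /subspace_continuousP cg cf Af p B /(cg _ (Af p)) gB.
apply: (@filterS _ (nbhs p) (nbhs_filter (p : (R * R)%type)) _ _ _ (cf p _ gB)) => q /= h.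
exact: h.
Qed.

Lemma clip_continuous (h : R -> R) : continuous h ->
  continuous (fun p : R * R => (p.1, h p.2)).
Proof.
move=> ch p.
apply: (@cvg_pair _ R R (nbhs p) (nbhs p.1) (nbhs (h p.2)) _ _ _ fst (h \o snd)).
  exact: cvg_fst.
exact: (@continuous_comp _ _ _ snd h p cvg_snd (ch p.2)).
Qed.

(** Projecting the plane onto the closed half-plane turns continuity within the closure into global
    continuity; the extension is then constant in [y] below, which is what the gluing exploits. *)
Lemma extend_upper u : extends_to_closure upper_half u ->
  exists g, [/\ continuous g, forall x y : R, 0 < y -> g (x, y) = u (x, y) &
    forall x y : R, y <= 0 -> g (x, y) = g (x, 0)].
Proof.
move=> [g [cg gu]].
exists (g \o (fun p => (p.1, Num.max p.2 0))); split.
- apply: within_continuous_comp cg _ _; last first.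
    by move=> p; apply: closure_upper; rewrite le_max lexx orbT.
  apply: (@clip_continuous (fun y : R^o => Num.max y 0)) => y.
  by apply: (@continuous_max R R^o id (cst 0)); [exact: cvg_id|exact: cvg_cst].
- by move=> x y y0 /=; rewrite (max_idPl (ltW y0)) gu.
- by move=> x y y0 /=; rewrite (max_idPr y0) maxxx.
Qed.

Lemma extend_lower u : extends_to_closure lower_half u ->
  exists g, [/\ continuous g, forall x y : R, y < 0 -> g (x, y) = u (x, y) &
    forall x y : R, 0 <= y -> g (x, y) = g (x, 0)].
Proof.
move=> [g [cg gu]].
exists (g \o (fun p => (p.1, Num.min p.2 0))); split.
- apply: within_continuous_comp cg _ _; last first.
    by move=> p; apply: closure_lower; rewrite ge_min lexx orbT.
  apply: (@clip_continuous (fun y : R^o => Num.min y 0)) => y.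
  by apply: (@continuous_min R R^o id (cst 0)); [exact: cvg_id|exact: cvg_cst].
- by move=> x y y0 /=; rewrite (min_idPl (ltW y0)) gu.
- by move=> x y y0 /=; rewrite (min_idPr y0) minxx.
Qed.

Lemma continuous_representative (a m : R) u : classC u -> transmission_solution a m u ->
  exists2 w, continuous w & forall x y, y != 0 -> w (x, y) = u (x, y).
Proof.
move=> [_ [eU _ _] [eL _ _] _] [_ _ _ tr].
have [gU [cU gUu gU0]] := extend_upper eU.
have [gL [cL gLu gL0]] := extend_lower eL.
have trace x : gU (x, 0) = gL (x, 0).
  have [l lr ll] := tr x.
  have hU : gU (x, t) @[t --> 0^'+] --> gU (x, 0).
    by apply: cvg_at_right_filter; exact: (@continuous_vline _ gU x cU 0).
  have hL : gL (x, t) @[t --> 0^'-] --> gL (x, 0).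
    by apply: cvg_at_left_filter; exact: (@continuous_vline _ gL x cL 0).
  have -> : gU (x, 0) = l.
    apply: (cvg_unique _ hU) => //; apply: cvg_trans lr; apply: near_eq_cvg.
    by near=> t; rewrite gUu//; near: t; exact: nbhs_right_gt.
  apply/esym; apply: (cvg_unique _ hL) => //; apply: cvg_trans ll; apply: near_eq_cvg.
  by near=> t; rewrite gLu//; near: t; exact: nbhs_left_lt.
(* On each side one extension is frozen at its trace, and the traces agree by the transmission
   condition, so the correction cancels it. *)
exists (fun p => gU p + gL p - gU (p.1, 0)) => [p|x y yn0].
  apply: cvgB; first by apply: cvgD; [exact: cU|exact: cL].
  have c0 := clip_continuous (@cst_continuous R R 0).
  exact: (@continuous_comp _ _ _ _ gU p (c0 p) (cU _)).
rewrite /=; have [y0|y0] := ltP 0 y.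
  by rewrite gL0 1?ltW// -trace addrK gUu.
rewrite gU0// addrAC subrr add0r gLu//.
by rewrite lt_neqAle yn0.
Unshelve. all: by end_near. Qed.

Lemma regular_representative (a m : R) u : classC u -> transmission_solution a m u ->
  exists w, regular_solution a m u w.
Proof.
move=> uC sol; have [w cw wE] := continuous_representative uC sol.
have [uL [_ dU d2U] [_ dL d2L] u0] := uC.
have ball_of p (P : set (R * R)) : nbhs p P -> exists2 e, 0 < e & ball p e `<=` P.
  by move=> /(@nbhs_ballP R (R * R)%type) [e e0 eP]; exists e.
have line0 := @lebesgue2_line R.
(* Null sets have dense complement, so an almost everywhere bound on a continuous function holds
   everywhere. *)
have lt_dense (g : R * R -> R) c : continuous g ->
    lebesgue2.-negligible [set p | c < g p] -> forall p, g p <= c.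
  move=> cg N p; rewrite leNgt; apply/negP => gp.
  have H := @cvgr_gt R _ _ (nbhs_filter (p : (R * R)%type)) g _ (cg p) _ gp.
  have [e e0 eP] := ball_of _ _ H.
  by have [q /eP qe] := negligible_near p N e0; apply.
have [M uM] := Linfty_bounded uL.
have wM : forall p, w p <= M.
  apply: lt_dense => //; apply: negligibleS (negligibleU uM line0) => -[x y] /= h.
  have [y0|yn0] := eqVneq y 0; [by right|left=> /= uMp].
  by move: h; rewrite wE// ltNge uMp.
have w0 : forall p, 0 <= w p.
  move=> p; rewrite -oppr_le0.
  apply: (lt_dense (fun p => - w p) 0).
    by move=> q; apply: cvgN; exact: cw.
  apply: negligibleS line0 => -[x y] /= h.
  apply: contrapT => yn0; move: h; rewrite wE; last exact/eqP.
  by rewrite oppr_gt0 ltNge u0.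
have e1in : (e1 : R * R) \in [:: e1; e2] by rewrite !inE eqxx.
have e2in : (e2 : R * R) \in [:: e1; e2] by rewrite !inE eqxx orbT.
exists w; split => //.
- by exists M.
- move=> x y; rewrite neq_lt => /orP[y0|y0]; first exact: (dL _ e1in).1.
  exact: (dU _ e1in).1.
- move=> x y; rewrite neq_lt => /orP[y0|y0]; first exact: (dL _ e2in).1.
  exact: (dU _ e2in).1.
- move=> x y; rewrite neq_lt => /orP[y0|y0]; first exact: (d2L _ _ e1in e1in).1.
  exact: (d2U _ _ e1in e1in).1.
- move=> x y; rewrite neq_lt => /orP[y0|y0]; first exact: (d2L _ _ e2in e2in).1.
  exact: (d2U _ _ e2in e2in).1.
Qed.

Lemma uniqueness (a m : R) u : 0 < a -> 0 < m ->
  classC u -> transmission_solution a m u -> nontrivial u ->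
  {ae lebesgue2, forall x, u x = U a m x.2}.
Proof.
move=> ha hm uC sol nt; have [w S] := regular_representative uC sol.
have [x [y [yn0 uxy]]] : exists x y, y != 0 /\ u (x, y) != 0.
  apply: contrapT => none; apply: nt.
  apply: negligibleS (@lebesgue2_line R) => -[x y] /= h.
  apply: contrapT => /eqP yn0; apply: h; apply: contrapT => /eqP uxy.
  by apply: none; exists x, y.
have wxy : w (x, y) != 0 by rewrite (rs_eq S).
have wU := unique_nonzero ha hm S wxy.
apply: negligibleS (@lebesgue2_line R) => -[x' y'] /= h.
by apply: contrapT => /eqP yn0'; apply: h; rewrite -(rs_eq S)// wU.
Qed.

End Representative.

(** * The profile is a solution *)

Section Existence.
Context {R : realType}.

Lemma derive_e1_snd (f : R -> R) : 'D_e1 (fun p : R * R => f p.2) = cst 0.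
Proof.
apply/funext => -[x y]; have d : is_derive x 1 (fun=> f y) 0 := is_derive_const (f y) x.
have E : (fun h : R => h^-1 *: (((fun p : R * R => f p.2) \o shift (x, y)) (h *: e1) - f y)) =
    cst 0.
  apply/funext => h /=.
  by rewrite -[X in f X - _]/(h * 0 + y) mulr0 add0r subrr scaler0.
by rewrite /derive /= E; exact: lim_cst.
Qed.

Lemma derivable_e1_snd (f : R -> R) p : derivable (fun p : R * R => f p.2) p e1.
Proof.
case: p => x y; rewrite /derivable.
have -> : (fun h : R => h^-1 *: (((fun p : R * R => f p.2) \o shift (x, y)) (h *: e1) - f y)) =
    cst 0.
  apply/funext => h /=.
  by rewrite -[X in f X - _]/(h * 0 + y) mulr0 add0r subrr scaler0.
exact: is_cvg_cst.
Qed.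

Let quotient_e2 (f : R -> R) (x y : R) :
  (fun h : R => h^-1 *: (((fun p : R * R => f p.2) \o shift (x, y)) (h *: e2) - f y)) =
  (fun h : R => h^-1 *: ((f \o shift y) (h *: (1 : R)) - f y)).
Proof. by []. Qed.

Lemma derive_e2_snd (f : R -> R) :
  'D_e2 (fun p : R * R => f p.2) = (fun p : R * R => 'D_1 f p.2).
Proof. by apply/funext => -[x y]; rewrite /derive /= quotient_e2. Qed.

Lemma derivable_e2_snd (f : R -> R) p : derivable f p.2 1 ->
  derivable (fun p : R * R => f p.2) p e2.
Proof. by case: p => x y; rewrite /derivable /= quotient_e2. Qed.

Lemma derive_e1_0 : 'D_e1 (cst 0 : R * R -> R) = cst 0.
Proof. exact: (derive_e1_snd (cst 0)). Qed.

Lemma derive_e2_0 : 'D_e2 (cst 0 : R * R -> R) = cst 0.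
Proof.
apply: etrans (derive_e2_snd (cst 0)) _.
by apply/funext => p; rewrite derive_cst.
Qed.

Lemma extends_snd (V : set (R * R)) (f h : R -> R) : continuous h ->
  (forall p, V p -> f p.2 = h p.2) -> extends_to_closure V (fun p => f p.2).
Proof.
move=> ch fh; exists (fun p => h p.2); split; last by move=> p /fh.
apply: continuous_subspaceT => p.
exact: (@continuous_comp _ _ _ snd h p cvg_snd (ch p.2)).
Qed.

Variables (D : set R) (f h h1 h2 : R -> R).
Hypotheses (openD : open D) (fh : forall y, D y -> f y = h y).
Hypotheses (dh : forall y : R, is_derive y 1 h (h1 y)).
Hypotheses (dh1 : forall y : R, is_derive y 1 h1 (h2 y)).
Hypothesis (ch2 : continuous h2).

Let nearD y : D y -> \forall z \near y, D z.
Proof. by move=> Dy; apply: open_nbhs_nbhs; split. Qed.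

Lemma is_derive_piece y : D y -> is_derive y 1 f (h1 y).
Proof.
move=> Dy; apply: near_eq_is_derive (dh y).
by apply: filterS (nearD Dy) => z /fh.
Qed.

Lemma derive_piece y : D y -> 'D_1 f y = h1 y.
Proof. by move=> /is_derive_piece[]. Qed.

Lemma is_derive2_piece y : D y -> is_derive y 1 ('D_1 f) (h2 y).
Proof.
move=> Dy; apply: near_eq_is_derive (dh1 y).
by apply: filterS (nearD Dy) => z /derive_piece.
Qed.

Lemma laplacian_piece p : D p.2 -> laplacian (fun p : R * R => f p.2) p = h2 p.2.
Proof.
move=> Dp; rewrite /laplacian (derive_e1_snd f) (derive_e2_snd f).
have := congr1 (fun g : R * R -> R => g p) derive_e1_0; rewrite /= => ->.
have := congr1 (fun g : R * R -> R => g p) (derive_e2_snd ('D_1 f)); rewrite /= => ->.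
by rewrite add0r; have [_] := is_derive2_piece Dp.
Qed.

(** On [D] the derivatives of [f] are those of [h], which are continuous on the whole line and thus
    supply the extensions to the closure. *)
Lemma C2_closure_piece : C2_closure [set p | D p.2] (fun p : R * R => f p.2).
Proof.
have ch := is_derive_continuous dh; have ch1 := is_derive_continuous dh1.
split; first by apply: extends_snd ch _ => p; exact: fh.
- move=> i; rewrite !inE => /orP[]/eqP ->; split.
  + by move=> p _; exact: derivable_e1_snd.
  + rewrite (derive_e1_snd f); apply: (@extends_snd _ (cst 0) (cst 0)) => //.
    exact: cst_continuous.
  + by move=> p Dp; apply: derivable_e2_snd; case: (is_derive_piece Dp).
  + by rewrite (derive_e2_snd f); apply: (@extends_snd _ ('D_1 f) h1 ch1) => p; exact: derive_piece.
- move=> i j; rewrite !inE => /orP[]/eqP -> /orP[]/eqP ->; split.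
  + by move=> p _; rewrite (derive_e1_snd f); exact: derivable_cst.
  + rewrite (derive_e1_snd f) derive_e1_0.
    by apply: (@extends_snd _ (cst 0) (cst 0)) => //; exact: cst_continuous.
  + move=> p _; rewrite (derive_e1_snd f); exact: derivable_cst.
  + rewrite (derive_e1_snd f) derive_e2_0.
    by apply: (@extends_snd _ (cst 0) (cst 0)) => //; exact: cst_continuous.
  + by move=> p _; rewrite (derive_e2_snd f); exact: (@derivable_e1_snd ('D_1 f) p).
  + rewrite (derive_e2_snd f) (derive_e1_snd ('D_1 f)).
    by apply: (@extends_snd _ (cst 0) (cst 0)) => //; exact: cst_continuous.
  + move=> p Dp; rewrite (derive_e2_snd f); apply: (@derivable_e2_snd ('D_1 f) p).
    by case: (is_derive2_piece Dp).
  + rewrite (derive_e2_snd f) (derive_e2_snd ('D_1 f)).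
    apply: (@extends_snd _ ('D_1 ('D_1 f)) h2 ch2) => p Dp.
    by have [_] := is_derive2_piece Dp.
Qed.

End Existence.

(** * Membership of the profile in the class, and its equations *)

Section ProfileSolution.
Context {R : realType}.
Variables (a m : R).
Hypotheses (ha : 0 < a) (hm : 0 < m).

Local Notation V := (upper_profile a m).
Local Notation V' := (upper_profile' a m).
Local Notation E := (lower_profile a m).
Local Notation kappa := (decay_rate a m).
Local Notation v := (fun p : R * R => U a m p.2).

Let openU : open [set y : R | 0 < y]. Proof. exact: open_gt. Qed.
Let openL : open [set y : R | y < 0]. Proof. exact: open_lt. Qed.

Let UV y : [set y : R | 0 < y] y -> U a m y = V y.
Proof. by move=> /= y0; rewrite UE ltW. Qed.

Let UL y : [set y : R | y < 0] y -> U a m y = E y.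
Proof. by move=> /= y0; rewrite UE (lt_geF y0). Qed.

Let dV := is_derive_upper_profile ha hm.
Let dV' := is_derive_upper_profile' ha hm.
Let dE := is_derive_lower_profile a m.
Let dE' (y : R) : is_derive y 1 (fun y => kappa * E y) (kappa * (kappa * E y)) :=
  is_derive_scale kappa (dE y).
Let cV := is_derive_continuous dV.
Let cE := is_derive_continuous dE.

Lemma profile_classC : classC v.
Proof.
split.
- apply: (@bounded_Linfty _ _ 1) => [|p].
    apply: (measurableT_comp _ measurable_snd).
    exact: continuous_measurable_fun (profile_continuous ha hm).
  by rewrite ger0_norm ltW ?U_lt1 ?U_gt0.
- have cV2 : continuous (fun y => - ((1 - V y ^+ 2) * V y)).
    move=> y; apply: cvgN; apply: cvgM; last exact: cV.
    by apply: cvgB; [exact: cvg_cst|apply: cvgM; exact: cV].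
  exact (C2_closure_piece openU UV dV dV' cV2).
- have cE2 : continuous (fun y => kappa * (kappa * E y)).
    by move=> y; apply: cvgM; [exact: cvg_cst|apply: cvgM; [exact: cvg_cst|exact: cE]].
  exact (C2_closure_piece openL UL dE dE' cE2).
- by move=> p; rewrite ltW ?U_gt0.
Qed.

Lemma profile_transmission : transmission_solution a m v.
Proof.
have cU := profile_continuous ha hm.
split.
- move=> p p0; rewrite (laplacian_piece openU UV dV dV' p0) opprK.
  by rewrite (UV p0).
- move=> p p0; rewrite (laplacian_piece openL UL dE dE' p0) (UL p0).
  have := sqr_decay_rate ha hm; rewrite expr2 => k2.
  by rewrite [kappa * _]mulrA k2; field; rewrite gt_eqF.
- move=> x; have dv t : 'D_e2 v (x, t) = 'D_1 (U a m) t.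
    exact: (congr1 (fun g : R * R -> R => g (x, t)) (derive_e2_snd (U a m))).
  exists (kappa * E 0).
    rewrite lower_profile0 -upper_profile'0//.
    have : V' t @[t --> 0^'+] --> V' 0.
      apply: cvg_at_right_filter; exact: (is_derive_continuous dV').
    apply: cvg_trans; apply: near_eq_cvg; near=> t; rewrite dv.
    apply/esym/(derive_piece openU UV dV).
    by rewrite /=; near: t; exact: nbhs_right_gt.
  have : kappa * E t @[t --> 0^'-] --> kappa * E 0.
    apply: cvg_at_left_filter; exact: (is_derive_continuous dE').
  apply: cvg_trans; apply: near_eq_cvg; near=> t; rewrite dv.
  apply/esym/(derive_piece openL UL dE).
  by rewrite /=; near: t; exact: nbhs_left_lt.
- move=> x; exists (U a m 0) => /=.
    by apply: cvg_at_right_filter; exact: cU.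
  by apply: cvg_at_left_filter; exact: cU.
Unshelve. all: by end_near. Qed.

Lemma profile_nontrivial : nontrivial v.
Proof.
move=> v0; have [q _] := negligible_near (0, 0) v0 ltr01; apply => /=.
by apply/eqP; rewrite gt_eqF ?U_gt0.
Qed.

End ProfileSolution.

Theorem theorem1p5 (R : realType) (a m : R) (ha : 0 < a) (hm : 0 < m) :
  let v := fun x : R * R => U a m x.2 in
  [/\ classC v, transmission_solution a m v, nontrivial v
    & forall u : R * R -> R,
        classC u -> transmission_solution a m u -> nontrivial u ->
        {ae lebesgue2, forall x, u x = v x}].
Proof.
split.
- exact: profile_classC.
- exact: profile_transmission.
- exact: profile_nontrivial.
- by move=> u uC sol nt; exact: uniqueness.
Qed.
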